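(* Let $(\Omega_i,\mu_i)$, $i=1,\dots,d$, be measure spaces, and for $S\subseteq\{1,\dots,d\}$ equip $\prod_{j\in S}\Omega_j$ with the product measure. (i) If $f_i\colon\prod_{j\neq i}\Omega_j\to[0,\infty)$ are measurable for $i=1,\dots,d$, then $$\int_{\prod_{j=1}^d\Omega_j}\prod_{i=1}^d f_i(x_1,\dots,\widehat{x}_i,\dots,x_d)\,d\mu_1(x_1)\cdots d\mu_d(x_d)\le\prod_{i=1}^d\|f_i\|_{L^{d-1}(\prod_{j\ne i}\Omega_j)}.$$ (ii) If $f\colon\prod_{j=1}^d\Omega_j\to[0,\infty)$ is measurable, $0<p\le1$, and $\theta_1,\dots,\theta_d>0$ with $\sum_i\theta_i=1$, then $$\|f\|_{L^p(\prod_{j=1}^d\Omega_j)}\le\prod_{i=1}^d\|f_i\|_{L^{p_i}(\prod_{j\ne i}\Omega_j)}^{\theta_i},$$ where $p_i$ is defined by $\frac1{d-1}\left(1-\frac1p\right)=\theta_i\left(1-\frac1{p_i}\right)$ and $f_i(x_1,\dots,\widehat{x}_i,\dots,x_d):=\int_{\Omega_i}f(x_1,\dots,x_d)\,d\mu_i(x_i)$ is the $i$-th marginal. In particular, for all $0<p\le1$, $\|f\|_{L^p(\prod_j\Omega_j)}\le\prod_{i=1}^d\|f_i\|_{L^{\frac{p(d-1)}{d-p}}(\prod_{j\ne i}\Omega_j)}^{1/d}$. (iii) If in (ii) $p<1$ and both sides of the inequality in (ii) are finite and non-zero, then equality holds in (ii) if and only if there exist measurable $E_j\subseteq\Omega_j$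 of positive finite measure ($j=1,\dots,d$) and $c>0$ such that $f(x_1,\dots,x_d)=c\prod_{j=1}^d1_{E_j}(x_j)$ for almost every $(x_1,\dots,x_d)$.
   Context: $\widehat{x}_i$ denotes omission of the variable $x_i$.
   Formalization: The measure spaces are assumed sigma-finite, so that the product measure is canonical and equals the iterated integral (for Lebesgue times counting measure on [0,1] the diagonal violates (ii)), and d is assumed at least 2. *)

(* Defs.v *)
From HB Require Import structures.
From mathcomp Require Import all_boot all_order all_algebra.
From mathcomp Require Import all_classical all_reals all_analysis.
Set Implicit Arguments. Unset Strict Implicit. Unset Printing Implicit Defensive.
Import Order.TTheory GRing.Theory Num.Theory.
Import numFieldNormedType.Exports.
Local Open Scope classical_set_scope.
Local Open Scope ring_scope.

(* Finite products  prod_{j in s} Omega_j  of a family of measure spaces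
   (Omega_j, mu_j), j : 'I_d.  A point of the product over the index list s is
   a dependent function  x : forall j, j \in s -> T j.
   The product sigma-algebra is the one generated by the coordinate maps, and
   integration against the product measure of a nonnegative function is
   computed as the iterated integral (Tonelli; the measures are sigma-finite
   in the theorem). *)
Section ProdSpaces.
Variables (R : realType) (d : nat) (disp : 'I_d -> measure_display).
Variable T : forall i : 'I_d, measurableType (disp i).
Variable mu : forall i : 'I_d, {measure set (T i) -> \bar R}.

Definition PS (s : seq 'I_d) := forall j : 'I_d, j \in s -> T j.

Lemma in_cons_neq (i j : 'I_d) (s : seq 'I_d) : j \in i :: s -> i <> j -> j \in s.
Proof. by rewrite in_cons => /orP[/eqP -> //|]. Qed.

Lemma not_in_nil (j : 'I_d) : j \in ([::] : seq 'I_d) -> False.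
Proof. by rewrite in_nil. Qed.

Definition pnil : PS [::] := fun j h => False_rect _ (not_in_nil h).

Definition pext (i : 'I_d) (s : seq 'I_d) (t : T i) (y : PS s) : PS (i :: s) :=
  fun j hj => match i =P j with
              | ReflectT e => eq_rect i (fun k => T k) t j e
              | ReflectF ne => y j (in_cons_neq hj ne)
              end.

Definition prestr (s s' : seq 'I_d) (H : {subset s' <= s}) (x : PS s) : PS s' :=
  fun j h => x j (H j h).

Fixpoint pint (s : seq 'I_d) : (PS s -> \bar R) -> \bar R :=
  match s return (PS s -> \bar R) -> \bar R with
  | [::] => fun g => g pnil
  | i :: s' => fun g => pint (fun y => (\int[mu i]_t g (pext t y))%E)
  end.

Definition psigma (s : seq 'I_d) : set (set (PS s)) :=
  <<s [set C | exists j (h : j \in s) (A : set (T j)),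
               measurable A /\ C = [set x | A (x j h)]] >>.

Definition pmeasurable (s : seq 'I_d) (g : PS s -> R) :=
  forall B : set R, measurable B -> psigma (g @^-1` B).

Definition pnorm (s : seq 'I_d) (p : R) (g : PS s -> \bar R) : \bar R :=
  ((pint (fun x => `|g x| `^ p)) `^ p^-1)%E.

Definition pnull (s : seq 'I_d) (N : set (PS s)) :=
  exists M, psigma M /\ N `<=` M /\ pint (fun x => (\1_M x)%:E) = 0%E.

Definition full : seq 'I_d := enum 'I_d.
Definition omit (i : 'I_d) : seq 'I_d := [seq j <- enum 'I_d | j != i].

Lemma in_full (j : 'I_d) : j \in full.
Proof. by rewrite /full mem_enum. Qed.

Lemma sub_omit (i : 'I_d) : {subset omit i <= full}.
Proof. by move=> j _; exact: in_full. Qed.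

Lemma full_cons_omit (i : 'I_d) : {subset full <= i :: omit i}.
Proof.
move=> j _; rewrite in_cons /omit mem_filter mem_enum andbT.
by case: eqVneq.
Qed.

Definition drop_coord (i : 'I_d) (x : PS full) : PS (omit i) :=
  prestr (@sub_omit i) x.

Definition marginal (f : PS full -> R) (i : 'I_d) : PS (omit i) -> \bar R :=
  fun y => (\int[mu i]_t (f (prestr (@full_cons_omit i) (pext t y)))%:E)%E.

Definition pcoord (x : PS full) (j : 'I_d) : T j := x j (in_full j).

End ProdSpaces.

Arguments marginal {R d disp T} mu f i _.
Arguments drop_coord {d disp T} i x _ _.

(* Main.v *)
Require Import Defs.
From HB Require Import structures.
From mathcomp Require Import all_boot all_order all_algebra.
From mathcomp Require Import all_classical all_reals all_analysis.
From mathcomp Require Import measurable_realfun ring lra.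
Set Implicit Arguments. Unset Strict Implicit. Unset Printing Implicit Defensive.
Import Order.TTheory GRing.Theory Num.Theory.
Import numFieldNormedType.Exports.
Local Open Scope classical_set_scope.
Local Open Scope ring_scope.

(* Pull every function back to the space of full coordinate vectors, where
   integrating out the coordinate j is an operator int1 j; by Tonelli these
   operators commute.  If the functions G_k carry weights w_k > 0 such that, for
   each j, the weights of the G_k that depend on x_j sum to 1, then integrating
   out one coordinate at a time with Hoelder's inequality gives Finner's
   inequality  int prod_k G_k^(w_k) <= prod_k (int G_k)^(w_k).
   Part (i) is the case of the weights 1/(d-1).  Part (ii) is the case of the 2d
   functions f f_i^(p_i-1), with weight theta_i p, and f_i^(p_i), with weight
   (1-p)/(d-1): the weighted product is f^p, and f f_i^(p_i-1) has the same
   integral as f_i^(p_i).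
   Equality forces equality in each Hoelder step, i.e. the G_k that depend on
   x_j are proportional to each other in x_j.  When every pair i <> j is
   separated by some G_k depending on x_i but not on x_j, this makes
   F = prod_k G_k^(w_k) a tensor product of functions g_j of one variable, and
   the G_k that depend on all variables proportional to F.  In (ii) F = f^p is
   thus proportional to f f_i^(p_i-1) for each i, so that where f > 0 its value
   does not depend on x_i: each g_i is constant on its support E_i. *)

(** * Products and powers of extended reals *)

Section ereal_products.
Context {R : realType}.
Local Open Scope ereal_scope.
Implicit Types x y : \bar R.

Lemma mule_gt0_lty x y : 0 <= x -> 0 <= y -> 0 < x * y < +oo ->
  (0 < x < +oo) && (0 < y < +oo).
Proof.
move=> x0 y0 /andP[xy0 xyoo].
have [x1 y1] : 0 < x /\ 0 < y by apply/andP; rewrite -mule_ge0_gt0.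
rewrite x1 y1/=; apply/andP; split; rewrite ltNge leye_eq; apply/eqP => e; move: xyoo.
- by rewrite e gt0_mulye ?ltxx.
- by rewrite e gt0_muley ?ltxx.
Qed.

Lemma gt0_lty_mule x y : 0 < x < +oo -> 0 < y < +oo -> 0 < x * y < +oo.
Proof.
move: x y => [x| |] [y| |] //=; rewrite ?lte_fin ?ltry ?andbT ?andbF //.
exact: mulr_gt0.
Qed.

Lemma mule_cancel x y z : 0 < z < +oo -> z * x = z * y -> x = y.
Proof.
move=> /andP[z0 zoo]; have zf : z \is a fin_num by rewrite ge0_fin_numE// ltW.
move: z z0 zoo zf => [z| |]// z0 _ _ e; rewrite lte_fin in z0.
have : (z^-1)%:E * (z%:E * x) = (z^-1)%:E * (z%:E * y) by rewrite e.
by rewrite !muleA -EFinM mulVf ?gt_eqF// !mul1e.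
Qed.

Lemma prode_ge0 (I : Type) (r : seq I) (P : pred I) (a : I -> \bar R) :
  (forall i, P i -> 0 <= a i) -> 0 <= \prod_(i <- r | P i) a i.
Proof. by move=> a0; elim/big_ind : _ => // u v; exact: mule_ge0. Qed.

Lemma prode_gt0_lty (I : finType) (P : pred I) (a : I -> \bar R) (i : I) :
  (forall j, 0 <= a j) -> 0 < \prod_(j | P j) a j < +oo -> P i ->
  0 < a i < +oo.
Proof.
move=> a0 + Pi; rewrite (bigD1 i)//= => /mule_gt0_lty.
by case/(_ (a0 i) (prode_ge0 _ (fun j _ => a0 j)))/andP.
Qed.

Lemma gt0_lty_prode (I : Type) (r : seq I) (P : pred I) (a : I -> \bar R) :
  (forall j, P j -> 0 < a j < +oo) -> 0 < \prod_(j <- r | P j) a j < +oo.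
Proof.
move=> a0; elim/big_ind : _ => //; last exact: gt0_lty_mule.
by rewrite lte01 ltry.
Qed.

Lemma lee_prod (I : Type) (r : seq I) (P : pred I) (a b : I -> \bar R) :
  (forall j, P j -> 0 <= a j <= b j) ->
  \prod_(j <- r | P j) a j <= \prod_(j <- r | P j) b j.
Proof.
move=> ab; have : 0 <= \prod_(j <- r | P j) a j <= \prod_(j <- r | P j) b j.
  elim/big_ind2 : _ => // [|u v w z /andP[? ?] /andP[? ?]].
    by rewrite lexx lee01.
  by rewrite mule_ge0// lee_pmul.
by case/andP.
Qed.

Lemma poweR_gt0_lty x (r : R) : 0 < x < +oo -> 0 < x `^ r < +oo.
Proof. by move=> /andP[x0 xoo]; rewrite poweR_gt0//= poweR_lty. Qed.

Lemma gt0_lty_poweR x (r : R) : (0 < r)%R -> 0 <= x -> 0 < x `^ r < +oo ->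
  0 < x < +oo.
Proof.
move=> r0 x0 /andP[h1 h2]; rewrite (gt0_poweR r0 x0 h1)//=.
by rewrite (lty_poweRy _ h2)// gt_eqF.
Qed.

Lemma poweR_prod (I : Type) (r : seq I) (P : pred I) (a : I -> \bar R) (p : R) :
  (forall j, P j -> 0 <= a j) ->
  (\prod_(j <- r | P j) a j) `^ p = \prod_(j <- r | P j) (a j `^ p).
Proof.
move=> a0; have : (\prod_(j <- r | P j) a j) `^ p = \prod_(j <- r | P j) (a j `^ p)
   /\ 0 <= \prod_(j <- r | P j) a j.
  apply: (big_rec2 (fun u v => v `^ p = u /\ 0 <= v)) => [|i u v Pi [<- v0]].
    by rewrite poweR1r.
  by rewrite poweRM ?a0// mule_ge0// a0.
by case.
Qed.

Lemma prode_eq0 (I : finType) (P : pred I) (a : I -> \bar R) (i : I) :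
  P i -> a i = 0 -> \prod_(j | P j) a j = 0.
Proof. by move=> Pi ai; rewrite (bigD1 i)//= ai mul0e. Qed.

Lemma prode_gt0 (I : finType) (P : pred I) (a : I -> \bar R) :
  (forall i, P i -> 0 < a i) -> 0 < \prod_(j | P j) a j.
Proof. by move=> a0; elim/big_ind : _ => // u v; exact: mule_gt0. Qed.

Lemma emeasurable_prod d (T : measurableType d) (I : Type) (r : seq I)
    (P : pred I) (D : set T) (h : I -> T -> \bar R) :
  (forall i, P i -> measurable_fun D (h i)) ->
  measurable_fun D (fun x : T => \prod_(i <- r | P i) h i x).
Proof.
move=> mh; elim: r => [|i r ih].
  by apply: eq_measurable_fun (measurable_cst 1) => x _; rewrite big_nil.
have [Pi|nPi] := boolP (P i); last first.
  by apply: eq_measurable_fun ih => x _; rewrite big_cons (negbTE nPi).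
apply: eq_measurable_fun (emeasurable_funM (mh i Pi) ih) => x _.
by rewrite big_cons Pi.
Qed.

End ereal_products.

Lemma powR_sum {R : realType} (I : Type) (r : seq I) (P : pred I) (w : I -> R)
    (a : R) : 0 < a ->
  a `^ (\sum_(i <- r | P i) w i) = \prod_(i <- r | P i) a `^ w i.
Proof. by move=> a0; rewrite /powR gt_eqF// mulr_suml expR_sum. Qed.

(** * The weighted AM-GM inequality with its equality case *)

Section amgm.
Context {R : realType} {K : finType} (P : pred K) (w : K -> R).
Hypothesis w0 : forall k, P k -> 0 < w k.
Hypothesis w1 : \sum_(k | P k) w k = 1.

(** This is ln u <= u - 1 multiplied by v and exponentiated; at u = 0 the left side is 0 because v >
    0. *)
Lemma powR_le_expR (u v : R) : 0 <= u -> 0 < v -> u `^ v <= expR (v * (u - 1)).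
Proof.
move=> u0 v0; move: u0; rewrite le_eqVlt => /predU1P[<-|u0].
  by rewrite powR0 ?gt_eqF// expR_ge0.
rewrite /powR gt_eqF// ler_expR ler_pM2l//.
have := expR_ge1Dx (ln u); rewrite lnK ?posrE//; lra.
Qed.

(** Bounding each factor by [powR_le_expR] leaves the exponential of a sum that vanishes when the
    weighted mean is 1. In the equality case the nonnegative terms w_k (u_k - 1 - ln u_k) sum to 0,
    and u - 1 - ln u vanishes only at u = 1. *)
Lemma amgm_normalized (u : K -> R) : (forall k, P k -> 0 <= u k) ->
  \sum_(k | P k) w k * u k = 1 ->
  \prod_(k | P k) u k `^ w k <= 1 ?= iff [forall (k | P k), u k == 1].
Proof.
move=> u0 s1.
have s0 : \sum_(k | P k) w k * (u k - 1) = 0.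
  by under eq_bigr do rewrite mulrBr mulr1; rewrite sumrB s1 w1 subrr.
split.
  apply: (@le_trans _ _ (\prod_(k | P k) expR (w k * (u k - 1)))).
    by apply: ler_prod => k Pk; rewrite powR_ge0 powR_le_expR ?u0 ?w0.
  by rewrite -expR_sum s0 expR0.
apply/idP/idP => [/eqP p1|/forall_inP u1]; last first.
  by rewrite big1// => k Pk; rewrite (eqP (u1 k Pk)) powR1.
have uP k : P k -> 0 < u k.
  move=> Pk; rewrite lt_neqAle u0// andbT; apply/eqP => uk0; have := p1.
  rewrite (bigD1 k)//= -uk0 powR0 ?gt_eqF ?w0// mul0r => /esym/eqP.
  by rewrite oner_eq0.
have l0 : \sum_(k | P k) w k * ln (u k) = 0.
  apply: expR_inj; rewrite expR0 -[RHS]p1 expR_sum; apply: eq_bigr => k Pk.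
  by rewrite /powR gt_eqF ?uP.
have : \sum_(k | P k) w k * (u k - 1 - ln (u k)) = 0.
  by under eq_bigr do rewrite mulrBr; rewrite sumrB s0 l0 subrr.
have lnle k : P k -> 0 <= u k - 1 - ln (u k).
  by move=> Pk; have := expR_ge1Dx (ln (u k)); rewrite lnK ?posrE ?uP//; lra.
move=> /psumr_eq0P H; apply/forall_inP => k Pk.
have /eqP := H (fun k Pk => mulr_ge0 (ltW (w0 Pk)) (lnle k Pk)) k Pk.
rewrite mulf_eq0 gt_eqF ?w0//= => /eqP e.
have [l|l] := eqVneq (ln (u k)) 0; first by apply/eqP; move: e; rewrite l; lra.
by have := expR_gt1Dx l; rewrite lnK ?posrE ?uP//; lra.
Qed.

(** By homogeneity, dividing every u_k by the weighted mean S reduces to the normalized case; if S =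
    0 then all u_k vanish. *)
Lemma amgm (u : K -> R) : (forall k, P k -> 0 <= u k) ->
  \prod_(k | P k) u k `^ w k <= \sum_(k | P k) w k * u k
    ?= iff [forall (k | P k), u k == \prod_(l | P l) u l `^ w l].
Proof.
move=> u0; set S := \sum_(k | P k) _; set p := \prod_(k | P k) _.
have S0 : 0 <= S by apply: sumr_ge0 => k Pk; rewrite mulr_ge0 ?u0// ltW ?w0.
have p0 : 0 <= p by apply: prodr_ge0 => *; exact: powR_ge0.
have uS : (forall k, P k -> u k = p) -> S = p.
  move=> up; rewrite /S; transitivity (\sum_(k | P k) w k * p).
    by apply: eq_bigr => k Pk; rewrite up.
  by rewrite -mulr_suml w1 mul1r.
have back : [forall (k | P k), u k == p] -> p == S.
  by move=> /forall_inP H; rewrite uS// => k Pk; exact/eqP/H.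
have [Sp|Sp] := eqVneq S 0.
  have u00 k : P k -> u k = 0.
    move=> Pk; have /(_ _ _) H := psumr_eq0P _ Sp.
    have /eqP := H (fun k Pk => mulr_ge0 (ltW (w0 Pk)) (u0 k Pk)) k Pk.
    by rewrite mulf_eq0 gt_eqF ?w0//= => /eqP.
  have pp : p = 0.
    have [k Pk] : exists k, P k.
      apply: contrapT => H; have := w1; rewrite big1 => [/esym/eqP|k Pk].
        by rewrite oner_eq0.
      by exfalso; apply: H; exists k.
    by rewrite /p (bigD1 k)//= u00// powR0 ?gt_eqF ?w0// mul0r.
  split; first by rewrite pp Sp.
  by rewrite pp Sp eqxx; apply/esym/forall_inP => k Pk; rewrite u00.
have S1 : 0 < S by rewrite lt_neqAle eq_sym Sp.
have pS : p = S * \prod_(k | P k) (u k / S) `^ w k.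
  have -> : S * \prod_(k | P k) (u k / S) `^ w k =
      \prod_(k | P k) S `^ w k * \prod_(k | P k) (u k / S) `^ w k.
    by rewrite -powR_sum// w1 powRr1.
  rewrite -big_split/=; apply: eq_bigr => k Pk.
  rewrite -powRM ?divr_ge0 ?u0//.
  by rewrite mulrC divfK.
have [] := @amgm_normalized (fun k => u k / S).
- by move=> k Pk; rewrite divr_ge0 ?u0.
- by under eq_bigr do rewrite mulrA; rewrite -mulr_suml mulfV.
rewrite -(ler_pM2l S1) mulr1 -pS => pSle eqS; split => //.
apply/idP/idP => // /eqP pS1.
have : \prod_(k | P k) (u k / S) `^ w k == 1.
  by apply/eqP/(mulfI Sp); rewrite -pS mulr1.
rewrite eqS => /forall_inP H; apply/forall_inP => k Pk.
by rewrite pS1 -[S]mul1r -(eqP (H k Pk)) divfK.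
Qed.

Local Open Scope ereal_scope.

(** An infinite u_k makes the weighted sum infinite and both claims trivial; otherwise everything is
    real. *)
Lemma amgm_ereal (u : K -> \bar R) : (forall k, 0 <= u k) ->
  \prod_(k | P k) u k `^ w k <= \sum_(k | P k) (w k)%:E * u k /\
  (\sum_(k | P k) (w k)%:E * u k < +oo ->
   \prod_(k | P k) u k `^ w k = \sum_(k | P k) (w k)%:E * u k ->
   forall k, P k -> u k = \prod_(l | P l) u l `^ w l).
Proof.
move=> u0.
have [[k Pk ky]|fu] := pselect (exists2 k, P k & u k = +oo).
  rewrite (_ : \sum_(k | P k) _ = +oo).
    by split; rewrite ?leey ?ltxx.
  apply/eqP; rewrite esum_eqy; last first.
    by move=> i Pi; rewrite gt_eqF// (@lt_le_trans _ _ 0)// mule_ge0// lee_fin ltW ?w0.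
  by apply/existsP; exists k; rewrite unfold_in Pk ky gt0_muley ?lte_fin ?w0.
have uE k : P k -> u k = (fine (u k))%:E.
  move=> Pk; rewrite fineK// ge0_fin_numE// lt_neqAle leey andbT.
  by apply/eqP => uk; apply: fu; exists k.
have -> : \prod_(k | P k) u k `^ w k = (\prod_(k | P k) fine (u k) `^ w k)%:E.
  by rewrite -prodEFin; apply: eq_bigr => k Pk; rewrite {1}uE.
have -> : \sum_(k | P k) (w k)%:E * u k = (\sum_(k | P k) w k * fine (u k))%:E.
  by rewrite -sumEFin; apply: eq_bigr => k Pk; rewrite {1}uE.
have [|le1 eq1] := @amgm (fun k => fine (u k)); first by move=> k _; exact: fine_ge0.
rewrite lee_fin; split => // _ [] /eqP; rewrite eq1 => /forall_inP H k Pk.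
by rewrite uE// (eqP (H k Pk)).
Qed.

End amgm.

(** * Hoelder's inequality for finitely many functions *)

Section integral_ge0_facts.
Context d (T : measurableType d) {R : realType} (m : {measure set T -> \bar R}).
Local Open Scope ereal_scope.
Implicit Types f g : T -> \bar R.

Lemma ge0_ae_eq0 f : measurable_fun setT f -> (forall t, 0 <= f t) ->
  \int[m]_t f t = 0 <-> {ae m, forall t, f t = 0}.
Proof.
move=> mf f0; have -> : \int[m]_t f t = \int[m]_t `|f t|.
  by apply: eq_integral => t _; rewrite gee0_abs.
split => [/(ae_eq_integral_abs m measurableT mf)|H].
  by apply: filterS => t /(_ I).
by apply/(ae_eq_integral_abs m measurableT mf); apply: filterS H => t.
Qed.

Lemma ge0_ae_lty f : measurable_fun setT f -> (forall t, 0 <= f t) ->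
  \int[m]_t f t < +oo -> {ae m, forall t, f t < +oo}.
Proof.
move=> mf f0 foo; have fi : m.-integrable setT f.
  apply/integrableP; split => //.
  by rewrite (eq_integral f)// => t _; rewrite gee0_abs.
apply: filterS (integrable_ae measurableT fi) => t /(_ I).
by rewrite ge0_fin_numE.
Qed.

Lemma ge0_ae_eq_of_le f g : measurable_fun setT f -> measurable_fun setT g ->
  (forall t, 0 <= f t <= g t) -> \int[m]_t g t < +oo ->
  \int[m]_t f t = \int[m]_t g t -> {ae m, forall t, f t = g t}.
Proof.
move=> mf mg fg goo efg.
have f0 t : 0 <= f t by case/andP: (fg t).
have g0 t : 0 <= g t by case/andP: (fg t) => /le_trans; apply.
(* Where f and g are both +oo the difference is -oo; integrating [|h t|] keeps the integrand
   nonnegative, and f is finite almost everywhere. *)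
pose h t := g t - f t.
have mh : measurable_fun setT h by exact: emeasurable_funB.
have foo := ge0_ae_lty mf f0 (eq_ind_r (fun x => x < +oo) goo efg).
have hE : {ae m, forall t, `|h t| + f t = g t}.
  apply: filterS foo => t ft; rewrite /h.
  have ff : f t \is a fin_num by rewrite ge0_fin_numE.
  rewrite gee0_abs ?subeK// sube_ge0 ?ff//.
  by case/andP: (fg t).
have mah : measurable_fun setT (fun t => `|h t|) by exact: measurableT_comp.
have ff : \int[m]_t f t \is a fin_num.
  by rewrite efg ge0_fin_numE// integral_ge0.
have ih0 : \int[m]_t `|h t| = 0.
  have e : \int[m]_t `|h t| + \int[m]_t f t = \int[m]_t f t.
    rewrite -ge0_integralD// efg; apply: ge0_ae_eq_integral => //.
    - exact: emeasurable_funD.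
    - by move=> t _; rewrite adde_ge0.
    - by apply: filterS hE => t.
  by rewrite -[LHS](addeK _ ff) e subee.
have := (ge0_ae_eq0 mah (fun t => abse_ge0 _)).1 ih0.
by apply: filterS2 hE => t <- ->; rewrite add0e.
Qed.

End integral_ge0_facts.

Section hoelder_prod.
Context d (T : measurableType d) {R : realType} (m : {measure set T -> \bar R}).
Context {K : finType} (P : pred K) (w : K -> R) (G : K -> T -> \bar R).
Local Open Scope ereal_scope.
Hypothesis w0 : forall k, P k -> (0 < w k)%R.
Hypothesis w1 : (\sum_(k | P k) w k = 1)%R.
Hypothesis mG : forall k, measurable_fun setT (G k).
Hypothesis G0 : forall k t, 0 <= G k t.

Let A := \prod_(k | P k) (\int[m]_t G k t) `^ w k.
Let F t := \prod_(k | P k) G k t `^ w k.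

Let mF : measurable_fun setT F.
Proof.
by apply: emeasurable_prod => k _; apply: (measurableT_comp (measurable_poweR _)).
Qed.

Let F0 t : 0 <= F t.
Proof. by apply: prode_ge0 => k _; exact: poweR_ge0. Qed.

Let S t := \sum_(k | P k) (w k)%:E * ((fine (\int[m]_s G k s))^-1%:E * G k t).

(** Each G k is divided by its integral, so that S, the weighted arithmetic mean of the results, has
    integral 1. AM-GM at each point gives F <= A S, and its equality case gives the proportionality
    of the G k. *)
Let normalized : 0 < A < +oo -> 
  [/\ forall k, P k -> 0 < \int[m]_s G k s < +oo,
      measurable_fun setT S,
      forall t, 0 <= F t <= A * S t,
      \int[m]_t (A * S t) = A &
      forall t, S t < +oo -> F t = A * S t -> forall k, P k ->
       G k t * A = \int[m]_s G k s * F t].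
Proof.
move=> A01; have /andP[A0 Aoo] := A01.
have G01 k : P k -> 0 < \int[m]_s G k s < +oo.
  move=> Pk; apply: (gt0_lty_poweR (w0 Pk)); first exact: integral_ge0.
  apply: (prode_gt0_lty (P := P) (a := fun k => (\int[m]_s G k s) `^ w k)) => //.
  by move=> j; exact: poweR_ge0.
pose a k := fine (\int[m]_s G k s).
have aE k : P k -> \int[m]_s G k s = (a k)%:E.
  by move=> Pk; rewrite fineK// ge0_fin_numE ?integral_ge0//; case/andP: (G01 k Pk).
have a0 k : P k -> (0 < a k)%R.
  by move=> Pk; rewrite -lte_fin -aE//; case/andP: (G01 k Pk).
pose u k t := if P k then (a k)^-1%:E * G k t else 0.
have u0 k t : 0 <= u k t.
  by rewrite /u; case: ifPn => // Pk; rewrite mule_ge0// lee_fin invr_ge0 ltW ?a0.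
have mu_ k : measurable_fun setT (u k).
  rewrite /u; case: (P k); last exact: measurable_cst.
  exact: measurable_funeM.
have SE t : S t = \sum_(k | P k) (w k)%:E * u k t.
  by apply: eq_bigr => k Pk; rewrite /u Pk.
have mS : measurable_fun setT S.
  rewrite (_ : S = fun t => \sum_(k <- enum P) (w k)%:E * u k t).
    by apply: emeasurable_sum => k; exact: measurable_funeM.
  by apply/funext => t; rewrite SE big_enum.
have FE t : F t = A * \prod_(k | P k) u k t `^ w k.
  rewrite /A -big_split/=; apply: eq_bigr => k Pk.
  rewrite -poweRM ?integral_ge0// /u Pk aE// muleA -EFinM mulfV ?mul1e//.
  by rewrite gt_eqF ?a0.
split => //.
- move=> t; rewrite F0/= FE lee_pmul2l ?gt0_fin_numE//.
  by rewrite SE; exact: (amgm_ereal w0 w1 (fun k => u0 k t)).1.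
- rewrite ge0_integralZl//; last first.
  + exact: ltW.
  + move=> t _; rewrite SE; apply: sume_ge0 => k Pk.
    by rewrite mule_ge0// lee_fin ltW ?w0.
  rewrite [X in A * X](_ : _ = 1) ?mule1//.
  transitivity (\int[m]_t \sum_(k <- enum P) (w k)%:E * u k t).
    by apply: eq_integral => t _; rewrite SE big_enum.
  rewrite (@ge0_integral_sum _ _ _ m _ _ K (fun k t => (w k)%:E * u k t))//; last 2 first.
  + by move=> k; exact: measurable_funeM.
  + move=> k t _; rewrite /u; case: ifPn => Pk; last by rewrite mule0.
    by rewrite mule_ge0 ?mule_ge0// lee_fin ?invr_ge0 ltW ?w0 ?a0.
  rewrite big_enum/= -w1 -sumEFin; apply: eq_bigr => k /= Pk.
  have {}Pk : P k := Pk.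
  rewrite ge0_integralZl ?lee_fin//; last exact/ltW/w0.
  rewrite /u Pk ge0_integralZl ?lee_fin ?invr_ge0//; last exact/ltW/a0.
  by rewrite aE// -EFinM mulVf ?mulr1 ?mule1// gt_eqF ?a0.
- move=> t; rewrite SE FE => Soo /(mule_cancel A01) e k Pk.
  have := (amgm_ereal w0 w1 (fun k => u0 k t)).2 Soo e k Pk.
  move=> <-; rewrite {1}/u Pk aE// [RHS]muleCA [_%:E * (_ * _)]muleA.
  by rewrite -EFinM mulfV ?gt_eqF ?a0// mul1e muleC.
Qed.

(** The degenerate values are apart: A = +oo is trivial, and A = 0 forces some G k to vanish almost
    everywhere, hence F too, because 0 to a positive power is 0. *)
Lemma hoelder_prod : \int[m]_t F t <= A.
Proof.
have [A01|nA] := boolP (0 < A < +oo).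
  have [_ mS FS iS _] := normalized A01.
  rewrite -[leRHS]iS; apply: ge0_le_integral => //.
    exact: measurable_funeM.
  by move=> t _; case/andP: (FS t).
have A0 : 0 <= A by apply: prode_ge0 => k _; exact: poweR_ge0.
move: nA; rewrite negb_and -!leNgt => /orP[Ale0|]; last first.
  by rewrite leye_eq => /eqP ->; rewrite leey.
have [k Pk k0] : exists2 k, P k & \int[m]_t G k t = 0.
  apply: contrapT => H; move: Ale0; apply/negP; rewrite -ltNge.
  apply: prode_gt0 => k Pk; apply: poweR_gt0.
  rewrite lt_neqAle integral_ge0// andbT; apply/eqP => e.
  by apply: H; exists k.
rewrite (_ : \int[m]_t F t = 0)//.
apply/ge0_ae_eq0 => //; move/ge0_ae_eq0 : k0 => /(_ (mG k) (G0 k)).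
apply: filterS => t Gk0; apply: (prode_eq0 Pk).
by rewrite Gk0 poweR0r// gt_eqF ?w0.
Qed.

(* Stated without division: the G k are proportional to each other. *)
Lemma hoelder_prod_eq : 0 < A < +oo -> \int[m]_t F t = A ->
  {ae m, forall t, forall k, P k -> G k t * A = \int[m]_s G k s * F t}.
Proof.
move=> A01 FA; have /andP[A0 Aoo] := A01.
have [_ mS FS iS eqS] := normalized A01.
have mAS : measurable_fun setT (fun t => A * S t) by exact: measurable_funeM.
have AS0 t : 0 <= A * S t by case/andP: (FS t) => /le_trans; apply.
have iASoo : \int[m]_t (A * S t) < +oo by rewrite iS.
have FAS := ge0_ae_eq_of_le mF mAS FS iASoo (etrans FA (esym iS)).
apply: filterS2 FAS (ge0_ae_lty mAS AS0 iASoo) => t FtS Soo.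
apply: eqS => //; rewrite ltNge leye_eq; apply/eqP => Sy.
by move: Soo; rewrite Sy gt0_muley ?ltxx.
Qed.

End hoelder_prod.

(** * Iterated integrals on a product of measurable spaces *)

Section product_space.
Context {I : eqType} {disp : I -> measure_display}.
Variable T : forall i : I, measurableType (disp i).

Definition cylinders : set (set (forall j, T j)) :=
  [set C | exists j (A : set (T j)), measurable A /\ C = [set x | A (x j)]].

Definition Pi : measurableType cylinders.-sigma := g_sigma_algebraType cylinders.

(** The case split is the one of [pext], which makes [restr (i :: s) (upd x t)] convertible to
    [pext t (restr s x)] in the transfer to [PS]. *)
Definition upd (x : Pi) (j : I) (t : T j) : Pi := fun k =>
  match j =P k with
  | ReflectT e => eq_rect j (fun i => T i) t k e
  | ReflectF _ => x k
  end.

Lemma upd_same x j t : upd x t j = t.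
Proof.
rewrite /upd; case: eqP => // e.
by rewrite (eq_irrelevance e (erefl j)).
Qed.

Lemma upd_other x j t k : j != k -> upd (j := j) x t k = x k.
Proof. by rewrite /upd; case: eqP. Qed.

Lemma measurable_coord (j : I) : measurable_fun setT (fun x : Pi => x j).
Proof.
move=> _ A mA; rewrite setTI; apply: sub_gen_smallest.
by exists j, A.
Qed.

Lemma measurable_fun_Pi d (X : measurableType d) (f : X -> Pi) :
  (forall j, measurable_fun setT (fun x => f x j)) -> measurable_fun setT f.
Proof.
move=> mf; apply: (@measurability _ _ _ _ setT f cylinders) => //.
move=> _ [_ [j [A [mA ->]]] <-]; rewrite setTI.
by have := mf j measurableT A mA; rewrite setTI.
Qed.

Lemma measurable_upd (j : I) :
  measurable_fun setT (fun z : (Pi * T j)%type => upd z.1 z.2).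
Proof.
apply: measurable_fun_Pi => k.
have [e|jk] := eqVneq j k.
  subst k; apply: eq_measurable_fun measurable_snd.
  by move=> z _ /=; rewrite upd_same.
have mk := @measurableT_comp _ _ _ _ Pi (T k) (fun x => x k) setT
  (@fst Pi (T j)) (@measurable_coord k) measurable_fst.
by apply: eq_measurable_fun mk => z _ /=; rewrite upd_other.
Qed.

Lemma upd_updC x i j (s : T i) (t : T j) : i != j ->
  upd (upd x s) t = upd (upd x t) s.
Proof.
move=> ij; apply/functional_extensionality_dep => k.
have [e|jk] := eqVneq j k.
  by subst k; rewrite upd_same upd_other// upd_same.
rewrite (upd_other _ _ jk).
have [e|ik] := eqVneq i k; first by subst k; rewrite !upd_same.
by rewrite !upd_other.
Qed.

Lemma upd_upd x i (s t : T i) : upd (upd x s) t = upd x t.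
Proof.
apply/functional_extensionality_dep => k.
have [e|ik] := eqVneq i k; first by subst k; rewrite !upd_same.
by rewrite !upd_other.
Qed.

End product_space.

Section iterated_integral.
Context {R : realType} {I : eqType} {disp : I -> measure_display}.
Context {T : forall i : I, measurableType (disp i)}.
Variable mu : forall i, {sigma_finite_measure set (T i) -> \bar R}.
Local Open Scope ereal_scope.
Local Notation Om := (Pi T).

Implicit Types (f g h : Om -> \bar R) (x y z : Om) (s : seq I).

Definition nnmeas g := measurable_fun setT g /\ forall x, 0 <= g x.

Definition int1 (j : I) g : Om -> \bar R := fun x => \int[mu j]_t g (upd x t).

Fixpoint itg s g : Om -> \bar R :=
  match s with
  | [::] => g
  | j :: s' => itg s' (int1 j g)
  end.

Lemma measurable_upd1 x (j : I) :
  measurable_fun setT (fun t : T j => upd x t : Om).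
Proof. exact: (measurableT_comp (@measurable_upd _ _ _ j) (measurable_pair1 x)). Qed.

Lemma nnmeas_sec g x j : nnmeas g ->
  measurable_fun setT (fun t : T j => g (upd x t)).
Proof. by move=> [mg _]; apply: (measurableT_comp mg (@measurable_upd1 x j)). Qed.

Lemma nnmeas_int1 j g : nnmeas g -> nnmeas (int1 j g).
Proof.
move=> [mg g0]; split; last by move=> x; exact: integral_ge0.
have mgu := @measurableT_comp _ _ _ _ Om _ g setT _ mg (@measurable_upd _ _ T j).
have gu0 (z : Om * T j) : 0 <= (g \o (fun z : Om * T j => upd z.1 z.2)) z by exact: g0.
exact: measurable_fun_fubini_tonelli_F mgu gu0.
Qed.

Lemma nnmeas_itg s g : nnmeas g -> nnmeas (itg s g).
Proof. by elim: s g => //= j s ih g mg; apply/ih/nnmeas_int1. Qed.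

Lemma int1C i j g : nnmeas g -> int1 i (int1 j g) = int1 j (int1 i g).
Proof.
move=> [mg g0]; have [->//|ij] := eqVneq i j.
apply/funext => x; rewrite /int1.
(* Up to [m4]: the map sending (s, t) to [g (upd (upd x s) t)] is measurable on T i * T j, as
   Tonelli requires. *)
have m1 := @measurableT_comp _ _ _ _ (T i) Om _ setT (@fst (T i) (T j))
  (@measurable_upd1 x i) measurable_fst.
have m2 := measurable_fun_pair m1 (@measurable_snd _ _ (T i) (T j)).
have m3 := @measurableT_comp _ _ _ _ _ Om _ setT _ (@measurable_upd _ _ T j) m2.
have m4 := @measurableT_comp _ _ _ _ Om _ g setT _ mg m3.
rewrite (fubini_tonelli _ m4)/=; last by move=> z; exact: g0.
apply: eq_integral => t _; apply: eq_integral => u _.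
by rewrite upd_updC.
Qed.

Lemma itg_int1C s j g : nnmeas g -> itg s (int1 j g) = int1 j (itg s g).
Proof.
elim: s g => //= i s ih g mg; rewrite int1C// ih//.
exact: nnmeas_int1.
Qed.

Lemma itg_cat s s' g : itg (s ++ s') g = itg s' (itg s g).
Proof. by elim: s g => //= j s ih g. Qed.

(** The head of s occurs somewhere in s'; [itg_int1C] moves its integration to the front, and the
    rest is the induction hypothesis. *)
Lemma itg_perm s s' g : perm_eq s s' -> nnmeas g -> itg s g = itg s' g.
Proof.
elim: s s' g => [|j s ih] s' g; first by rewrite perm_sym => /perm_nilP ->.
move=> + mg; have [js'|js' /perm_mem/(_ j)] := boolP (j \in s'); last first.
  by rewrite mem_head (negbTE js').
move: js' => /path.splitPr[s1 s2] p.
rewrite /= (ih (s1 ++ s2)); last exact: nnmeas_int1.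
  by rewrite !itg_cat/= itg_int1C.
by rewrite -(perm_cons j) (perm_trans p)// perm_catC/= perm_cons perm_catC.
Qed.

Lemma int1_le j f g : nnmeas f -> nnmeas g -> (forall x, f x <= g x) ->
  forall x, int1 j f x <= int1 j g x.
Proof.
move=> mf mg fg x; apply: ge0_le_integral => //.
- by move=> t _; exact: mf.2.
- exact: nnmeas_sec.
- exact: nnmeas_sec.
Qed.

Lemma itg_le s f g : nnmeas f -> nnmeas g -> (forall x, f x <= g x) ->
  forall x, itg s f x <= itg s g x.
Proof.
elim: s f g => //= j s ih f g mf mg fg.
by apply: ih; [exact: nnmeas_int1|exact: nnmeas_int1|exact: int1_le].
Qed.

Lemma nnmeas_cst (c : \bar R) : 0 <= c -> nnmeas (fun=> c).
Proof. by move=> c0; split. Qed.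

Lemma nnmeasM f g : nnmeas f -> nnmeas g -> nnmeas (fun x => f x * g x).
Proof.
move=> [mf f0] [mg g0]; split; first exact: emeasurable_funM.
by move=> x; rewrite mule_ge0.
Qed.

Lemma nnmeas_poweR f (p : R) : nnmeas f -> nnmeas (fun x => f x `^ p).
Proof.
move=> [mf f0]; split; first exact: (measurableT_comp (measurable_poweR p) mf).
by move=> x; exact: poweR_ge0.
Qed.

Lemma nnmeas_prod (K : Type) (r : seq K) (P : pred K) (G : K -> Om -> \bar R) :
  (forall k, nnmeas (G k)) -> nnmeas (fun x => \prod_(k <- r | P k) G k x).
Proof.
move=> mG; split; first by apply: emeasurable_prod => k _; case: (mG k).
by move=> x; apply: prode_ge0 => k _; case: (mG k).
Qed.

Lemma nnmeas_coord (j : I) (a : T j -> \bar R) : measurable_fun setT a ->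
  (forall t, 0 <= a t) -> nnmeas (fun x => a (x j)).
Proof. by move=> ma a0; split => //; exact: (measurableT_comp ma (@measurable_coord _ _ _ j)). Qed.

Definition depends (A : pred I) g :=
  forall x y, (forall k, A k -> x k = y k) -> g x = g y.

Lemma depends_sub (A B : pred I) g : subpred A B -> depends A g -> depends B g.
Proof. by move=> AB dg x y xy; apply: dg => k /AB /xy. Qed.

Lemma depends_upd (A : pred I) g x j (t : T j) : depends A g -> ~~ A j ->
  g (upd x t) = g x.
Proof.
move=> dg Aj; apply: dg => k Ak; rewrite upd_other//.
by apply: contraNneq Aj => ->.
Qed.

Lemma depends_int1 (A : pred I) j g : depends A g ->
  depends [pred k | A k & k != j] (int1 j g).
Proof.
move=> dg x y xy; apply: eq_integral => t _; apply: dg => k Ak.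
have [e|jk] := eqVneq j k; first by subst k; rewrite !upd_same.
by rewrite !upd_other//; apply: xy; rewrite /= Ak eq_sym.
Qed.

Lemma depends_itg (A : pred I) s g : depends A g ->
  depends [pred k | A k & k \notin s] (itg s g).
Proof.
elim: s A g => [|j s ih] A g dg /=.
  by apply: depends_sub dg => k /= ->.
have := ih _ _ (depends_int1 (j := j) dg).
by apply: depends_sub => k /=; rewrite in_cons negb_or andbA.
Qed.

Lemma dependsT g : depends xpredT g.
Proof.
move=> x y xy; congr g.
by apply/functional_extensionality_dep => k; exact: xy.
Qed.

Lemma int1_Zl j f g : nnmeas f -> nnmeas g -> depends (predC1 j) f ->
  int1 j (fun x => f x * g x) = fun x => f x * int1 j g x.
Proof.
move=> mf mg df; apply/funext => x; rewrite /int1.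
have e (t : T j) : f (upd x t) = f x.
  by apply: (depends_upd _ _ df); rewrite /= eqxx.
under eq_integral do rewrite e.
rewrite ge0_integralZl//; first exact: nnmeas_sec.
  by move=> t _; exact: mg.2.
exact: mf.2.
Qed.

Lemma itg_cstl s c g x : 0 <= c -> nnmeas g ->
  itg s (fun y => c * g y) x = c * itg s g x.
Proof.
move=> c0; elim: s g => //= j s ih g mg.
by rewrite int1_Zl// ih//; exact: nnmeas_int1.
Qed.

End iterated_integral.

(** * Iterated almost-everywhere quantifiers *)

Section iterated_ae.
Context {R : realType} {I : eqType} {disp : I -> measure_display}.
Context {T : forall i : I, measurableType (disp i)}.
Variable mu : forall i, {sigma_finite_measure set (T i) -> \bar R}.
Local Open Scope ereal_scope.
Local Notation Om := (Pi T).

Implicit Types (f g h : Om -> \bar R) (x y z : Om) (s : seq I) (P Q : Om -> Prop).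

(* The innermost quantifier binds the first index of s, as in itg and pint. *)
Fixpoint aes s P : Om -> Prop :=
  match s with
  | [::] => P
  | j :: s' => aes s' (fun y => {ae mu j, forall t, P (upd y t)})
  end.

Lemma aes_mono s P Q x : (forall y, P y -> Q y) -> aes s P x -> aes s Q x.
Proof.
elim: s P Q => [|j s ih] P Q PQ /=; first exact: PQ.
by apply: ih => y; apply: filterS => t; exact: PQ.
Qed.

Lemma aes_and s P Q x : aes s P x -> aes s Q x -> aes s (fun y => P y /\ Q y) x.
Proof.
elim: s P Q => [|j s ih] P Q /= p q; first by split.
by apply: aes_mono (ih _ _ p q) => y [+ +]; apply: filterS2 => t.
Qed.

Lemma aes_mono2 s P1 P2 Q x : (forall y, P1 y -> P2 y -> Q y) ->
  aes s P1 x -> aes s P2 x -> aes s Q x.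
Proof. by move=> PQ p1 p2; apply: aes_mono (aes_and p1 p2) => y []; exact: PQ. Qed.

Lemma aes_true s P x : (forall y, P y) -> aes s P x.
Proof.
elim: s P => [|j s ih] P p /=; first exact: p.
by apply: ih => y; exact: filterE.
Qed.

Lemma aes_cons s P Q x j : (forall y, Q y -> {ae mu j, forall t, P (upd y t)}) ->
  aes s Q x -> aes (j :: s) P x.
Proof. by move=> QP Qs /=; apply: aes_mono Qs. Qed.

(** This translates between almost-everywhere statements and vanishing integrals, so that the
    symmetry of [itg] passes to [aes]. *)
Lemma aes_itg0 s g x : nnmeas g -> itg mu s g x = 0 <-> aes s (fun y => g y = 0) x.
Proof.
elim: s g => //= j s ih g mg; rewrite ih; last exact: nnmeas_int1.
have e y : int1 mu j g y = 0 <-> {ae mu j, forall t, g (upd y t) = 0}.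
  by apply: ge0_ae_eq0 => [|t]; [exact: nnmeas_sec|exact: mg.2].
by split; apply: aes_mono => y; rewrite e.
Qed.

Lemma int1_ae_le j f g z : nnmeas f -> nnmeas g ->
  {ae mu j, forall u, f (upd z u) <= g (upd z u)} ->
  int1 mu j f z <= int1 mu j g z.
Proof.
move=> mf mg fg; apply: ae_ge0_le_integral => //.
- by move=> t _; exact: mf.2.
- exact: nnmeas_sec.
- by move=> t _; exact: mg.2.
- exact: nnmeas_sec.
- by apply: filterS fg.
Qed.

Lemma int1_ae_eq j f g z : nnmeas f -> nnmeas g ->
  {ae mu j, forall u, f (upd z u) = g (upd z u)} ->
  int1 mu j f z = int1 mu j g z.
Proof.
move=> mf mg fg; apply/eqP; rewrite eq_le; apply/andP; split; apply: int1_ae_le => //;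
  by apply: filterS fg => t ->.
Qed.

Lemma aes_itg_le s f g x : nnmeas f -> nnmeas g ->
  aes s (fun y => f y <= g y) x -> itg mu s f x <= itg mu s g x.
Proof.
elim: s f g => //= j s ih f g mf mg fg.
apply: ih; [exact: nnmeas_int1|exact: nnmeas_int1|].
by apply: aes_mono fg => y; exact: int1_ae_le.
Qed.

Lemma aes_itg_eq s f g x : nnmeas f -> nnmeas g ->
  aes s (fun y => f y = g y) x -> itg mu s f x = itg mu s g x.
Proof.
move=> mf mg fg; apply/eqP; rewrite eq_le; apply/andP; split; apply: aes_itg_le => //;
  by apply: aes_mono fg => t ->.
Qed.

Lemma aes_lty s g x : nnmeas g -> itg mu s g x < +oo -> aes s (fun y => g y < +oo) x.
Proof.
elim: s g => //= j s ih g mg goo.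
have H := ih _ (nnmeas_int1 mu j mg) goo.
apply: aes_mono H => y; apply: ge0_ae_lty.
  exact: nnmeas_sec.
by move=> t; exact: mg.2.
Qed.

(** The inner integrals over x_j inherit the hypotheses, so by induction they agree and are finite
    at almost every outer point; there the one-variable case applies. *)
Lemma aes_eq_of_le s f g x : nnmeas f -> nnmeas g -> (forall y, f y <= g y) ->
  itg mu s g x < +oo -> itg mu s f x = itg mu s g x ->
  aes s (fun y => f y = g y) x.
Proof.
elim: s f g => //= j s ih f g mf mg fg goo efg.
have mf1 := nnmeas_int1 mu j mf; have mg1 := nnmeas_int1 mu j mg.
have fg1 := @int1_le _ _ _ _ mu j _ _ mf mg fg.
have H1 := ih _ _ mf1 mg1 fg1 goo efg; have H2 := aes_lty mg1 goo.
apply: (aes_mono2 _ H1 H2) => y e yoo; apply: (ge0_ae_eq_of_le _ _ _ yoo e).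
- exact: nnmeas_sec.
- exact: nnmeas_sec.
- by move=> t; rewrite mf.2 fg.
Qed.

(** The quantifiers only overwrite coordinates in s, so the others keep their values at the base
    point. *)
Lemma aes_off s x : aes s (fun z => forall k, k \notin s -> z k = x k) x.
Proof.
(* P is abstracted so that the induction on s' leaves the list s inside P fixed. *)
have [P PE] : exists P, P = (fun z => forall k, k \notin s -> z k = x k) by eexists.
suff H s' : {subset s' <= s} -> forall y, P y -> aes s' P y.
  by rewrite -PE; apply: H => //; rewrite PE.
elim: s' => //= j s' ih js y Py; apply: aes_mono (ih _ _ Py); last first.
  by move=> k ks; apply: js; rewrite in_cons ks orbT.
move=> z Pz; apply: filterE => t; move: Pz; rewrite PE => Pz k ks.
rewrite upd_other ?Pz//; apply: contraNneq ks => <-.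
by rewrite js ?mem_head.
Qed.

(** With the indicator of the complement as g, [aes_itg0] becomes applicable to any measurable
    property. *)
Lemma measurable_aes0 P : measurable [set y | P y] ->
  exists2 g : Om -> \bar R, nnmeas g & forall y, P y <-> g y = 0.
Proof.
move=> mP; exists (fun y => (\1_(~` [set y | P y]) y)%:E).
  split; last by move=> y; rewrite lee_fin.
  by apply/measurable_EFinP; apply: measurable_indic; exact: measurableC.
move=> y; rewrite indicE; have [Py|nPy] := pselect (P y).
  by rewrite memNset//=; apply.
by rewrite mem_set//=; split => // -[] /eqP; rewrite oner_eq0.
Qed.

(* Measurability is needed to exchange two almost-everywhere quantifiers. *)
Lemma aes_perm s s' P x : measurable [set y | P y] -> perm_eq s s' ->
  aes s P x -> aes s' P x.
Proof.
move=> /measurable_aes0[g mg gP] ss' H.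
apply: (@aes_mono _ (fun y => g y = 0)) => [y /gP//|].
apply/aes_itg0 => //; rewrite -(itg_perm _ ss')//.
by apply/aes_itg0 => //; apply: aes_mono H => y /gP.
Qed.

(** With this an almost-everywhere identity can be integrated over any x_m, m in s. Once m is the
    innermost index the inner statement no longer sees the m-th coordinate, by [upd_upd], and the
    order can be restored. *)
Lemma aes_upd s P x m : measurable [set y | P y] -> m \in s ->
  aes s P x -> aes s (fun z => {ae mu m, forall u, P (upd z u)}) x.
Proof.
move=> mP ms; have /perm_to_rem ss' := ms.
move=> /(aes_perm mP ss')/= H.
have mQ : measurable [set z | {ae mu m, forall u, P (upd z u)}].
  have [g mg gP] := measurable_aes0 mP.
  rewrite (_ : [set _ | _] = setT `&` [set z | int1 mu m g z = 0]); last first.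
    apply/seteqP; split=> [z /= H'|z [_ /= H']].
      split=> //; apply/ge0_ae_eq0; [exact: nnmeas_sec|by move=> u; exact: mg.2|].
      by apply: filterS H' => u /gP.
    have := (ge0_ae_eq0 (mu m) (nnmeas_sec z (j := m) mg) (fun t => mg.2 _)).1 H'.
    by apply: filterS => u /gP.
  apply: measurable_eqe => //; first by case: (nnmeas_int1 mu m mg).
rewrite perm_sym in ss'; apply: (aes_perm mQ ss') => /=.
apply: aes_mono H => y Py; apply: filterE => t.
by apply: filterS Py => u; rewrite upd_upd.
Qed.

Lemma measurable_eq_nnmeas f g : nnmeas f -> nnmeas g ->
  measurable [set y | f y = g y].
Proof.
by move=> [mf _] [mg _]; have := measurable_eqe measurableT mf mg; rewrite setTI.
Qed.

End iterated_ae.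

(** * Finner's inequality *)

Section finner.
Context {R : realType} {I : eqType} {disp : I -> measure_display}.
Context {T : forall i : I, measurableType (disp i)}.
Variable mu : forall i, {sigma_finite_measure set (T i) -> \bar R}.
Context {K : finType} (S : K -> pred I) (w : K -> R).
Hypothesis w0 : forall k, (0 < w k)%R.
Local Open Scope ereal_scope.
Local Notation Om := (Pi T).
Implicit Types (G : K -> Om -> \bar R) (x y z : Om) (s : seq I).

Definition wprod G : Om -> \bar R := fun x => \prod_k G k x `^ w k.

Definition marg j G k := if S k j then int1 mu j (G k) else G k.

Lemma nnmeas_wprod G : (forall k, nnmeas (G k)) -> nnmeas (wprod G).
Proof. by move=> mG; apply: nnmeas_prod => k; exact: nnmeas_poweR. Qed.

Lemma nnmeas_marg j G : (forall k, nnmeas (G k)) -> forall k, nnmeas (marg j G k).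
Proof. by move=> mG k; rewrite /marg; case: ifP => // _; exact: nnmeas_int1. Qed.

Lemma wprod_gt0_lty G x : (forall k, nnmeas (G k)) ->
  0 < wprod G x < +oo -> forall k, 0 < G k x < +oo.
Proof.
move=> mG H k; apply: (gt0_lty_poweR (w0 k)); first exact: (mG k).2.
apply: (prode_gt0_lty (P := xpredT) (a := fun k => G k x `^ w k)) => //.
by move=> j; exact: poweR_ge0.
Qed.

Section step.
Variables (j : I) (G : K -> Om -> \bar R).
Hypothesis w1 : (\sum_(k | S k j) w k = 1)%R.
Hypothesis mG : forall k, nnmeas (G k).
Hypothesis dG : forall k x (t : T j), ~~ S k j -> G k (upd x t) = G k x.

Lemma marg_upd k x (t : T j) : marg j G k (upd x t) = marg j G k x.
Proof.
rewrite /marg; case: ifPn => Skj; last exact: dG.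
by apply: eq_integral => u _; rewrite upd_upd.
Qed.

Lemma wprod_marg_upd x (t : T j) : wprod (marg j G) (upd x t) = wprod (marg j G) x.
Proof. by apply: eq_bigr => k _; rewrite marg_upd. Qed.

Let c x := \prod_(k | ~~ S k j) G k x `^ w k.

Let c0 x : 0 <= c x.
Proof. by apply: prode_ge0 => k _; exact: poweR_ge0. Qed.

Let wprodE x (t : T j) :
  wprod G (upd x t) = c x * \prod_(k | S k j) G k (upd x t) `^ w k.
Proof.
rewrite /wprod (bigID (S^~ j))/= muleC; congr (_ * _).
by apply: eq_bigr => k Skj; rewrite dG.
Qed.

Let wprod_margE x :
  wprod (marg j G) x = c x * \prod_(k | S k j) int1 mu j (G k) x `^ w k.
Proof.
rewrite /wprod (bigID (S^~ j))/= muleC; congr (_ * _).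
  by apply: eq_bigr => k /negbTE Skj; rewrite /marg Skj.
by apply: eq_bigr => k Skj; rewrite /marg Skj.
Qed.

Let P x (t : T j) := \prod_(k | S k j) G k (upd x t) `^ w k.

Let nnP x : measurable_fun setT (P x) /\ forall t, 0 <= P x t.
Proof.
split=> [|t]; last by apply: prode_ge0 => k _; exact: poweR_ge0.
apply: emeasurable_prod => k _.
exact: measurableT_comp (measurable_poweR _) (nnmeas_sec x (mG k)).
Qed.

Let int1_wprodE x : int1 mu j (wprod G) x = c x * \int[mu j]_t P x t.
Proof.
rewrite /int1; under eq_integral do rewrite wprodE.
by rewrite ge0_integralZl//; [exact: (nnP x).1|move=> t _; exact: (nnP x).2].
Qed.

(** The factors that do not depend on x_j form the constant [c x]; Hoelder's inequality in x_j
    applies to the others, whose weights sum to 1. *)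
Lemma int1_wprod_le x : int1 mu j (wprod G) x <= wprod (marg j G) x.
Proof.
rewrite int1_wprodE wprod_margE lee_wpmul2l//.
apply: (@hoelder_prod _ _ _ (mu j) K (S^~ j) w (fun k t => G k (upd x t))) => //.
- by move=> k; exact: nnmeas_sec.
- by move=> k t; exact: (mG k).2.
Qed.

(** If the product of marginals vanishes at x, then so does [wprod G] for almost every t, and both
    sides are 0. Otherwise [c x] is positive and finite and cancels, leaving the equality case of
    Hoelder. *)
Lemma int1_wprod_eq x : wprod (marg j G) x < +oo ->
  int1 mu j (wprod G) x = wprod (marg j G) x ->
  {ae mu j, forall t, forall k, S k j ->
    wprod G (upd x t) * marg j G k x = wprod (marg j G) x * G k (upd x t)}.
Proof.
move=> foo e.
have [f0|f0] := eqVneq (wprod (marg j G) x) 0.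
  have mF := nnmeas_wprod mG.
  have : {ae mu j, forall t, wprod G (upd x t) = 0}.
    apply/ge0_ae_eq0; [exact: nnmeas_sec|by move=> t; exact: mF.2|].
    by rewrite -f0.
  by apply: filterS => t -> k _; rewrite f0 !mul0e.
have f01 : 0 < wprod (marg j G) x < +oo.
  by rewrite foo andbT lt_neqAle eq_sym f0 (nnmeas_wprod (nnmeas_marg j mG)).2.
have A0 : 0 <= \prod_(k | S k j) int1 mu j (G k) x `^ w k.
  by apply: prode_ge0 => k _; exact: poweR_ge0.
have := f01; rewrite wprod_margE => /(mule_gt0_lty (c0 x) A0)/andP[c01 A01].
have PA : \int[mu j]_t P x t = \prod_(k | S k j) int1 mu j (G k) x `^ w k.
  by move: e; rewrite int1_wprodE wprod_margE => /(mule_cancel c01).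
have := @hoelder_prod_eq _ _ _ (mu j) K (S^~ j) w (fun k t => G k (upd x t))
  (fun k _ => w0 k) w1 (fun k => nnmeas_sec x (mG k)) (fun k t => (mG k).2 _) A01 PA.
apply: filterS => t H k Skj; rewrite wprodE -!muleA; congr (_ * _).
by rewrite /marg Skj muleC [RHS]muleC; exact/esym/H.
Qed.

End step.

(** Only the coordinates still to be integrated are constrained; those outside s are free
    parameters. In this form the condition passes from [j :: s] to [s] under [marg j]. *)
Definition Sdepends s G := forall k, depends [pred m | (m \in s) ==> S k m] (G k).

Lemma Sdepends_upd s G k x j (t : T j) : Sdepends s G -> j \in s -> ~~ S k j ->
  G k (upd x t) = G k x.
Proof.
move=> dG js Skj; apply: (depends_upd x t (dG k)).
by rewrite /= js.
Qed.

Lemma Sdepends_marg s j G : Sdepends (j :: s) G -> Sdepends s (marg j G).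
Proof.
move=> dG k; rewrite /marg; case: ifPn => Skj.
  have := depends_int1 mu (j := j) (dG k).
  apply: depends_sub => m /= /andP[+ mj].
  by rewrite in_cons (negbTE mj).
apply: depends_sub (dG k) => m /= /implyP H; apply/implyP => ms.
by apply: H; rewrite in_cons ms orbT.
Qed.

Definition finner_bound s G x :=
  \prod_k itg mu [seq j <- s | S k j] (G k) x `^ w k.

(** The bound is invariant under a Hoelder step, which is what lets the induction on s close. *)
Lemma finner_bound_cons j s G x :
  finner_bound (j :: s) G x = finner_bound s (marg j G) x.
Proof. by apply: eq_bigr => k _; rewrite /marg /=; case: ifP. Qed.

Theorem finner s G x :
  (forall j, j \in s -> \sum_(k | S k j) w k = 1)%R ->
  (forall k, nnmeas (G k)) -> Sdepends s G ->
  itg mu s (wprod G) x <= finner_bound s G x.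
Proof.
elim: s G => [|j s ih] G w1 mG dG; first exact: lexx.
have mF := nnmeas_wprod mG.
have mF' := nnmeas_wprod (nnmeas_marg j mG).
rewrite finner_bound_cons /=.
apply: (@le_trans _ _ (itg mu s (wprod (marg j G)) x)).
  apply: itg_le => //; first exact: nnmeas_int1.
  move=> y; apply: int1_wprod_le => //; first by rewrite w1// mem_head.
  by move=> k z t; apply: Sdepends_upd dG _; rewrite mem_head.
apply: ih; [|exact: nnmeas_marg|exact: Sdepends_marg].
by move=> i si; rewrite w1// in_cons si orbT.
Qed.

End finner.

(** * Equality in Finner's inequality *)

Section finner_equality.
Context {R : realType} {I : eqType} {disp : I -> measure_display}.
Context {T : forall i : I, measurableType (disp i)}.
Variable mu : forall i, {sigma_finite_measure set (T i) -> \bar R}.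
Context {K : finType} (S : K -> pred I) (w : K -> R).
Hypothesis w0 : forall k, (0 < w k)%R.
Local Open Scope ereal_scope.
Local Notation Om := (Pi T).
Local Notation marg := (marg mu S).
Local Notation wprod := (wprod w).
Implicit Types (G : K -> Om -> \bar R) (x y z : Om) (s : seq I).

(** The integral of [wprod (marg j G)] lies between the two ends of Finner's inequality. Equality of
    the ends forces equality in both links, and by finiteness the first link becomes an
    almost-everywhere equality. *)
Lemma itg_wprod_marg_eq s j G x : uniq (j :: s) ->
  (forall i, i \in j :: s -> \sum_(k | S k i) w k = 1)%R ->
  (forall k, nnmeas (G k)) -> Sdepends S (j :: s) G ->
  finner_bound mu S w (j :: s) G x < +oo ->
  itg mu (j :: s) (wprod G) x = finner_bound mu S w (j :: s) G x ->
  itg mu s (wprod (marg j G)) x = finner_bound mu S w s (marg j G) x /\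
  aes mu s (fun y => int1 mu j (wprod G) y = wprod (marg j G) y /\
                     wprod (marg j G) y < +oo) x.
Proof.
move=> /= /andP[js us] w1 mG dG; rewrite finner_bound_cons => Coo e.
have mF := nnmeas_wprod w mG.
have mG' := nnmeas_marg mu S j mG.
have mF' := nnmeas_wprod w mG'.
have le1 y : int1 mu j (wprod G) y <= wprod (marg j G) y.
  apply: int1_wprod_le => //; first by rewrite w1// mem_head.
  by move=> k z t; apply: Sdepends_upd dG _; rewrite mem_head.
have le2 : itg mu s (wprod (marg j G)) x <= finner_bound mu S w s (marg j G) x.
  apply: finner => //; last exact: Sdepends_marg.
  by move=> i si; rewrite w1// in_cons si orbT.
have e' : itg mu s (wprod (marg j G)) x = finner_bound mu S w s (marg j G) x.
  apply/eqP; rewrite eq_le le2/= -e; apply: itg_le => //.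
  exact: nnmeas_int1.
split => //; apply: aes_and; last by apply: aes_lty => //; rewrite e'.
apply: aes_eq_of_le => //; first exact: nnmeas_int1.
  by rewrite e'.
by rewrite e' -e.
Qed.

(** In F = g_m times the integral of F over x_m, the splitting already obtained for r is substituted
    under the integral; the g_i with i in r do not involve x_m and come out. *)
Lemma aes_prod_marginals s x F (r : seq I) (g : forall j, T j -> \bar R) :
  nnmeas F -> (forall j, measurable_fun setT (g j)) ->
  (forall j t, 0 <= g j t) -> uniq r -> {subset r <= s} ->
  (forall m, m \in r -> aes mu s (fun z => F z = g m (z m) * int1 mu m F z) x) ->
  aes mu s (fun z => F z = \prod_(i <- r) g i (z i) * itg mu r F z) x.
Proof.
move=> mF mg g0; elim: r => [_ _ _|m r ih /= /andP[mr ur] rs H].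
  by apply: aes_true => y; rewrite big_nil mul1e.
have mgr : nnmeas (fun z : Om => \prod_(i <- r) g i (z i)).
  by apply: nnmeas_prod => i; exact: nnmeas_coord.
have mir := nnmeas_itg mu r mF.
have {}ih : aes mu s (fun z => F z = \prod_(i <- r) g i (z i) * itg mu r F z) x.
  apply: ih => // i ir; first by apply: rs; rewrite in_cons ir orbT.
  by apply: H; rewrite in_cons ir orbT.
have ms : m \in s by apply: rs; rewrite mem_head.
have mP := measurable_eq_nnmeas mF (nnmeasM mgr mir).
apply: (aes_mono2 _ (H m (mem_head _ _)) (aes_upd mP ms ih)) => z -> e.
rewrite big_cons -muleA; congr (_ * _).
rewrite (int1_ae_eq mF (nnmeasM mgr mir) e) int1_Zl//; last first.
  move=> y y' yy'; rewrite !big_seq; apply: eq_bigr => i ir; congr (g i _).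
  by apply: yy' => /=; apply: contraNneq mr => <-.
by rewrite itg_int1C.
Qed.

(** Induction on s. Write F = [wprod G], F' = [wprod (marg j G)] and G' k = [marg j G k]. The
    induction hypothesis for the G' k supplies g_i for i in s. It is then shown that F splits off
    these same factors, and the remaining factor is a function of x_j. *)
Lemma finner_eq s G x : uniq s ->
  (forall i, i \in s -> \sum_(k | S k i) w k = 1)%R ->
  (forall i j, i \in s -> j \in s -> i != j -> exists k, S k i && ~~ S k j) ->
  (forall k, nnmeas (G k)) -> Sdepends S s G ->
  0 < finner_bound mu S w s G x < +oo ->
  itg mu s (wprod G) x = finner_bound mu S w s G x ->
  (exists g : forall j, T j -> \bar R,
    [/\ forall j, measurable_fun setT (g j),
        forall j t, 0 <= g j t,
        forall j, j \in s -> \int[mu j]_t g j t = 1 &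
        aes mu s (fun z => wprod G z =
          itg mu s (wprod G) x * \prod_(j <- s) g j (z j)) x]) /\
  (forall k, all (S k) s -> aes mu s (fun z =>
     G k z * itg mu s (wprod G) x = itg mu s (G k) x * wprod G z) x).
Proof.
elim: s G => [|j s ih] G us w1 sep mG dG C01 e.
  split=> [|k _ /=]; last by [].
  exists (fun j => cst 0); split => //=.
  by rewrite big_nil mule1.
have mF := nnmeas_wprod w mG.
have mG' := nnmeas_marg mu S j mG.
have mF' := nnmeas_wprod w mG'.
have /andP[C0 Coo] := C01.
have [e' E0] := itg_wprod_marg_eq us w1 mG dG Coo e.
have [js us'] := andP us.
have dGj k y (t : T j) : ~~ S k j -> G k (upd y t) = G k y.
  by apply: Sdepends_upd dG _; rewrite mem_head.
have eC : itg mu s (wprod (marg j G)) x = itg mu (j :: s) (wprod G) x.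
  by rewrite e' e finner_bound_cons.
have subs : {subset s <= j :: s} by move=> i si; rewrite in_cons si orbT.
have := ih (marg j G) us' (fun i si => w1 i (subs i si))
  (fun i l si sl => sep i l (subs i si) (subs l sl)) mG' (Sdepends_marg mu dG).
rewrite -finner_bound_cons => /(_ C01).
rewrite finner_bound_cons => /(_ e') [[g [mg g0 g1 gE]] Gfull].
rewrite eC in gE Gfull.
set C := itg mu (j :: s) (wprod G) x in gE Gfull *.
have C01' : 0 < C < +oo by rewrite /C e.
have up y (t : T j) : wprod (marg j G) (upd y t) = wprod (marg j G) y.
  exact: wprod_marg_upd.
(* Where F' = 0 the relation F * G' k = F' * G k carries no information, so the vanishing of F there
   is recorded separately. *)
have f1 : aes mu (j :: s) (fun z => [/\ wprod (marg j G) z < +oo,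
    wprod (marg j G) z = 0 -> wprod G z = 0 &
    forall k, S k j -> wprod G z * marg j G k z = wprod (marg j G) z * G k z]) x.
  apply: aes_cons E0 => y [Ey yoo].
  have H1 := int1_wprod_eq w0 (w1 j (mem_head _ _)) mG dGj yoo Ey.
  have H2 : {ae mu j, forall t, wprod (marg j G) y = 0 -> wprod G (upd y t) = 0}.
    have [y0|y0] := eqVneq (wprod (marg j G) y) 0; last first.
      by apply: filterE => t y0'; rewrite y0' eqxx in y0.
    have : {ae mu j, forall t, wprod G (upd y t) = 0}.
      apply/ge0_ae_eq0; [exact: nnmeas_sec|by move=> t; exact: mF.2|].
      by rewrite -y0.
    by apply: filterS => t.
  apply: filterS2 H1 H2 => t H1 H2; rewrite up; split => // k Skj.
  by rewrite marg_upd// H1.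
have f1k k : S k j -> aes mu (j :: s) (fun z =>
    wprod G z * marg j G k z = wprod (marg j G) z * G k z) x.
  by move=> Skj; apply: aes_mono f1 => z [_ _]; exact.
have pos z : wprod (marg j G) z < +oo -> wprod (marg j G) z != 0 ->
    0 < wprod (marg j G) z < +oo.
  by move=> -> z0; rewrite andbT lt_neqAle eq_sym z0 mF'.2.
split; last first.
  move=> k; rewrite [all _ _]/= => /andP[Skj Sks].
  (* By induction G' k is proportional to F', which with [f1] gives the claim after cancelling F'.
     Where F' = 0 also G' k = 0, and then G k = 0 for almost every x_j. *)
  have H1 : aes mu (j :: s) (fun z =>
      marg j G k z * C = itg mu (j :: s) (G k) x * wprod (marg j G) z /\
      (marg j G k z = 0 -> G k z = 0)) x.
    apply: (@aes_cons _ _ _ _ mu s _ _ x j _ (Gfull k Sks)) => y Hy.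
    have mk : marg j G k = int1 mu j (G k) by rewrite /marg Skj.
    have H2 : {ae mu j, forall t, marg j G k y = 0 -> G k (upd y t) = 0}.
      have [y0|y0] := eqVneq (marg j G k y) 0; last first.
        by apply: filterE => t y0'; rewrite y0' eqxx in y0.
      have : {ae mu j, forall t, G k (upd y t) = 0}.
        apply/ge0_ae_eq0; [exact: nnmeas_sec|by move=> t; exact: (mG k).2|].
        by rewrite -y0 mk.
      by apply: filterS => t.
    apply: filterS H2 => t H2; rewrite up marg_upd//; split => //.
    by rewrite Hy mk.
  apply: (aes_mono2 _ f1 H1) => z [zoo z0 fz] [Gz Gz0].
  have [F0|F0] := eqVneq (wprod (marg j G) z) 0.
    rewrite z0// mule0 Gz0 ?mul0e//.
    move: Gz; rewrite F0 mule0 => /eqP; rewrite mule_eq0.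
    case/orP => /eqP// C00; by move: C01'; rewrite C00 ltxx.
  apply: (mule_cancel (pos z zoo F0)).
  rewrite [LHS]muleA -fz// -[LHS]muleA Gz [LHS]muleCA [RHS]muleCA.
  by congr (_ * _); exact: muleC.
(* Since F' = C * prod g_i with each g_i of integral 1, integrating out x_m removes exactly the
   factor g_m. *)
have f3 : forall m, m \in s -> aes mu s (fun z => wprod (marg j G) z =
    g m (z m) * int1 mu m (wprod (marg j G)) z) x.
  move=> m ms.
  have mgs : nnmeas (fun z : Om => C * \prod_(i <- s) g i (z i)).
    apply: nnmeasM; first by apply: nnmeas_cst; apply/ltW; case/andP: C01'.
    by apply: nnmeas_prod => i; exact: nnmeas_coord.
  have mP := measurable_eq_nnmeas mF' mgs.
  apply: (aes_mono2 _ gE (aes_upd mP ms gE)) => z -> ez.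
  rewrite (int1_ae_eq mF' mgs ez) /int1 (bigD1_seq m)//= muleCA; congr (_ * _).
  set p := \prod_(i <- s | i != m) _.
  transitivity (\int[mu m]_t (C * p * g m t)).
    rewrite ge0_integralZl// ?g1 ?mule1//.
    by rewrite mule_ge0 ?prode_ge0// ltW//; case/andP: C01'.
  apply: eq_integral => t _; rewrite (bigD1_seq m)//= upd_same -muleA; congr (_ * _).
  rewrite muleC; congr (_ * _); apply: eq_bigr => i im.
  by rewrite upd_other// eq_sym.
(* If G k depends on x_j but not on x_m then F = F' * (G k / G' k), where F' is
   already a tensor product by induction and G k / G' k does not depend on x_m:
   hence F splits off the factor g m (x_m). *)
have E m : m \in s -> aes mu (j :: s) (fun z => wprod G z =
    g m (z m) * int1 mu m (wprod G) z) x.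
  move=> ms; have mj : m != j by apply: contraNneq js => <-.
  have jm : j != m by rewrite eq_sym.
  have [k /andP[Skj Skm]] := sep j m (mem_head _ _) (subs m ms) jm.
  have dk : depends (predC1 m) (G k).
    have := dG k; apply: depends_sub => i /= /implyP H.
    by apply: contraNneq Skm => e1; rewrite e1 in H; exact/H/subs.
  have dk' : depends (predC1 m) (marg j G k).
    have := @Sdepends_marg _ _ _ _ mu _ _ _ _ _ dG k; apply: depends_sub => i /= /implyP H.
    by apply: contraNneq Skm => e1; rewrite e1 in H; exact: H.
  (* The relation G' k * F = G k * F' is integrated over x_m, on which neither G k nor G' k
     depends. *)
  have f2 : aes mu (j :: s) (fun z => marg j G k z * int1 mu m (wprod G) z =
      G k z * int1 mu m (wprod (marg j G)) z) x.
    have mm := nnmeasM (mG' k) mF; have mm' := nnmeasM (mG k) mF'.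
    have : aes mu (j :: s) (fun z => marg j G k z * wprod G z =
        G k z * wprod (marg j G) z) x.
      by apply: aes_mono (f1k k Skj) => z fz; rewrite muleC fz muleC.
    move=> /(aes_upd (measurable_eq_nnmeas mm mm') (subs m ms)).
    apply: aes_mono => z /(int1_ae_eq mm mm').
    by rewrite !int1_Zl.
  have f3' : aes mu (j :: s) (fun z => wprod (marg j G) z =
      g m (z m) * int1 mu m (wprod (marg j G)) z) x.
    apply: aes_cons (f3 m ms) => y Hy; apply: filterE => t.
    rewrite up Hy upd_other; last by rewrite eq_sym.
    congr (_ * _); apply: eq_integral => u _.
    by rewrite upd_updC ?up// eq_sym.
  (* Needed where F' = 0. Integrating F over x_j and x_m gives the integral of F' over x_m; if that
     is 0, the integral of F over x_m is 0 for almost every x_j. *)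
  have f4 : aes mu (j :: s) (fun z => int1 mu m (wprod (marg j G)) z = 0 ->
      int1 mu m (wprod G) z = 0) x.
    have E0' : aes mu s (fun y => int1 mu j (wprod G) y = wprod (marg j G) y) x.
      by apply: aes_mono E0 => y [].
    have mi := nnmeas_int1 mu j mF.
    have E1 := aes_upd (measurable_eq_nnmeas mi mF') ms E0'.
    apply: aes_cons E1 => y /(int1_ae_eq mi mF'); rewrite int1C// => Ey.
    have ut (t : T j) : int1 mu m (wprod (marg j G)) (upd y t) =
        int1 mu m (wprod (marg j G)) y :> \bar R.
      apply: eq_integral => u _.
      by rewrite upd_updC ?up// eq_sym.
    have [y0|y0] := eqVneq (int1 mu m (wprod (marg j G)) y) 0; last first.
      by apply: filterE => t; rewrite ut => y0'; rewrite y0' eqxx in y0.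
    have mmF := nnmeas_int1 mu m mF.
    have : {ae mu j, forall t, int1 mu m (wprod G) (upd y t) = 0}.
      apply/ge0_ae_eq0; [exact: nnmeas_sec|by move=> t; exact: mmF.2|].
      by rewrite -y0 -Ey.
    by apply: filterS => t.
  have := aes_and (aes_and f1 f2) (aes_and f3' f4).
  apply: aes_mono => z [[[zoo z0 fz] f2z] [f3z f4z]].
  have [F0|F0] := eqVneq (wprod (marg j G) z) 0.
    rewrite z0//; move: f3z; rewrite F0 => /esym/eqP; rewrite mule_eq0.
    by case/orP => /eqP h; [rewrite h mul0e|rewrite f4z ?mule0].
  (* Where F' > 0, G' k is positive and finite, and cancels from G' k * F = G k * F' = G k * g_m *
     (integral of F') = g_m * G' k * (integral of F), the integrals being over x_m. *)
  have G01 := wprod_gt0_lty w0 mG' (pos z zoo F0) k.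
  apply: (mule_cancel G01).
  by rewrite muleC fz// [RHS]muleCA f2z muleCA -f3z muleC.
have mitg := nnmeas_itg mu s mF.
have Etot := @aes_prod_marginals (j :: s) x (wprod G) s g mF mg g0 us' subs E.
(* The factor left after splitting off all g_i with i in s is [itg mu s (wprod G)], a function of
   x_j alone once the coordinates outside [j :: s] are those of x. Dividing by C makes its integral
   1. *)
pose h i (t : T i) := (itg mu s (wprod G) (upd x t) * ((fine C)^-1)%:E).
have Cfin : C = (fine C)%:E.
  by rewrite fineK// ge0_fin_numE ?ltW//; case/andP: C01'.
have fC0 : (0 < fine C)%R by rewrite -lte_fin -Cfin; case/andP: C01'.
exists (fun i => if i == j then h i else g i); split.
- move=> i; case: ifP => // _.
  apply: emeasurable_funM; last exact: measurable_cst.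
  exact: nnmeas_sec.
- move=> i t; case: ifP => // _.
  by rewrite mule_ge0 ?mitg.2// lee_fin invr_ge0 ltW.
- move=> i; rewrite in_cons; case: eqVneq => [->|_] /= si; last exact: g1.
  rewrite ge0_integralZr//.
  + rewrite -/(int1 mu j (itg mu s (wprod G)) x) -itg_int1C//.
    rewrite -[itg mu s _ x]/(itg mu (j :: s) (wprod G) x) -/C {1}Cfin -EFinM.
    by rewrite mulfV// gt_eqF.
  + exact: nnmeas_sec.
  + by move=> t _; exact: mitg.2.
  + by rewrite lee_fin invr_ge0 ltW.
- apply: (aes_mono2 _ Etot (aes_off mu (j :: s) x)) => z -> offz.
  have -> : itg mu s (wprod G) z = itg mu s (wprod G) (upd x (z j)).
    apply: (@depends_itg _ _ _ _ mu _ s _ (@dependsT _ _ _ _ (wprod G))) => i /= si.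
    have [ij|ij] := eqVneq j i; first by subst i; rewrite upd_same.
    by rewrite upd_other// offz// in_cons negb_or eq_sym ij.
  rewrite big_cons eqxx muleC /h [X in _ = C * (X * _)]muleC -!muleA.
  rewrite [RHS]muleA {1}Cfin -EFinM mulfV ?gt_eqF// mul1e; congr (_ * _).
  rewrite !big_seq; apply: eq_bigr => i si.
  by rewrite ifF//; apply: contraNF js => /eqP <-.
Qed.

End finner_equality.

Lemma poweR_sum {R : realType} (J : Type) (r : seq J) (P : pred J) (w : J -> R)
    (x : \bar R) : (forall j, P j -> 0 < w j) ->
  (x `^ (\sum_(j <- r | P j) w j) = \prod_(j <- r | P j) x `^ w j)%E.
Proof.
move=> w0; have : (x `^ (\sum_(j <- r | P j) w j) = \prod_(j <- r | P j) x `^ w j)%E /\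
    0 <= \sum_(j <- r | P j) w j; last by case.
apply: (big_rec2 (fun u v => (x `^ u = v)%E /\ 0 <= u)) => [|j u v Pj [<- u0]].
  by rewrite poweRe0.
have ju : 0 < w j + u by rewrite ltr_pwDl ?w0.
by split; [rewrite poweRD// /poweRD_def gt_eqF|exact: ltW].
Qed.

Lemma aes_coord {R : realType} {I : eqType} {disp : I -> measure_display}
    {T : forall i : I, measurableType (disp i)}
    (mu : forall i, {sigma_finite_measure set (T i) -> \bar R})
    (s : seq I) (x : Pi T) (i : I) (P : T i -> Prop) :
  {ae mu i, forall t, P t} -> i \in s -> aes mu s (fun z => P (z i)) x.
Proof.
move=> aeP; elim: s => //= j s ih; rewrite in_cons.
have [e _|ij /= si] := eqVneq i j.
  subst j; apply: aes_true => y; apply: filterS aeP => t.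
  by rewrite upd_same.
apply: aes_mono (ih si) => y Py; apply: filterE => t.
by rewrite upd_other// eq_sym.
Qed.

Lemma card_neq (d : nat) (j : 'I_d) : #|[pred i : 'I_d | j != i]| = d.-1.
Proof.
have := cardC1 j; rewrite card_ord => <-; apply: eq_card => i.
by rewrite !inE eq_sym.
Qed.

(** * The adjoint Loomis-Whitney inequality *)

Section adjoint.
Context {R : realType} {d : nat} {disp : 'I_d -> measure_display}.
Context {T : forall i : 'I_d, measurableType (disp i)}.
Variable mu : forall i, {sigma_finite_measure set (T i) -> \bar R}.
(** Here [delta] stands for (1/p - 1)/(d - 1), and the equation defining p_i becomes theta_i / p_i =
    theta_i + delta. Positivity of [delta] excludes p = 1, where the weights of the f_i^(p_i) would
    vanish. *)
Variables (p delta : R) (theta pe : 'I_d -> R).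
Hypothesis d0 : (0 < d)%N.
Hypothesis p0 : 0 < p.
Hypothesis delta0 : 0 < delta.
Hypothesis pdelta : d.-1%:R * delta = p^-1 - 1.
Hypothesis theta0 : forall i, 0 < theta i.
Hypothesis theta1 : \sum_i theta i = 1.
Hypothesis pe0 : forall i, 0 < pe i.
Hypothesis thetape : forall i, theta i / pe i = theta i + delta.
Local Open Scope ereal_scope.
Local Notation Om := (Pi T).
Variable phi : Om -> \bar R.
Hypothesis mphi : nnmeas phi.
Hypothesis phioo : forall z, phi z < +oo.

Local Notation K := ('I_d + 'I_d)%type.

Let S (k : K) : pred 'I_d := if k is inr i then predC1 i else xpredT.

Let w (k : K) : R := (if k is inl i then theta i * p else p * delta)%R.

Let m i : Om -> \bar R := int1 mu i phi.

Let G (k : K) : Om -> \bar R :=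
  match k with
  | inl i => fun z => m i z `^ (pe i - 1) * phi z
  | inr i => fun z => m i z `^ pe i
  end.

Let F := wprod w G.

Let w0 k : (0 < w k)%R.
Proof. by case: k => i /=; rewrite mulr_gt0. Qed.

Let mm i : nnmeas (m i).
Proof. exact: nnmeas_int1. Qed.

Let mG k : nnmeas (G k).
Proof.
case: k => i /=; last exact: nnmeas_poweR.
by apply: nnmeasM => //; exact: nnmeas_poweR.
Qed.

Let mF : nnmeas F.
Proof. exact: nnmeas_wprod. Qed.

(** The indices [inl i] contribute p in total, and the d - 1 indices [inr i] with i != j contribute
    (d - 1) p delta = 1 - p. *)
Let sumw j : (\sum_(k | S k j) w k = 1)%R.
Proof.
rewrite big_sumType/= -mulr_suml theta1 mul1r sumr_const.
rewrite -[X in (_ *+ X)%R](_ : d.-1 = _); last first.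
  by rewrite -(card_neq j); apply: eq_card => i; rewrite !inE.
by rewrite -mulr_natl mulrCA pdelta mulrBr mulfV ?gt_eqF// mulr1 addrC subrK.
Qed.

Let m_upd i z (t : T i) : m i (upd z t) = m i z.
Proof. by apply: eq_integral => u _; rewrite upd_upd. Qed.

Let depends_m i : depends (predC1 i) (m i).
Proof.
have := depends_int1 mu (j := i) (@dependsT _ _ _ _ phi).
by apply: depends_sub => j /=.
Qed.

Let dG : Sdepends S (full d) G.
Proof.
move=> [] i z y zy /=.
  have zyE : z = y.
    by apply/functional_extensionality_dep => j; apply: zy; rewrite /= implybT.
  by rewrite zyE.
rewrite (_ : m i z = m i y)//; apply: depends_m => j /= ji; apply: zy.
by rewrite /= ji implybT.
Qed.

Let B i (x : Om) := itg mu (omit i) (fun z => m i z `^ pe i) x.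

Lemma perm_full_omit (i : 'I_d) : perm_eq (full d) (i :: omit i).
Proof.
apply: (perm_trans (perm_to_rem (in_full i))).
by rewrite /full /omit rem_filter ?enum_uniq// perm_cons.
Qed.

(* This holds everywhere, thanks to +oo `^ r = +oo for r < 0 and
   0 `^ r = 0 for r <> 0. *)
Let int1_inl i : int1 mu i (G (inl i)) = fun z => m i z `^ pe i.
Proof.
rewrite /= int1_Zl//; last 2 first.
- exact: nnmeas_poweR.
- by move=> y z yz; rewrite (depends_m yz).
apply/funext => z; rewrite -/(m i) -{2}(poweRe1 ((mm i).2 z)) -poweRD ?subrK//.
by rewrite /poweRD_def subrK gt_eqF.
Qed.

Let itg_inl i x : itg mu (full d) (G (inl i)) x = B i x.
Proof. by rewrite (itg_perm mu (perm_full_omit i) (mG (inl i)))/= int1_inl. Qed.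

(** [G (inl i)] and [G (inr i)] have the same integral [B i], so their weights add up to theta_i p +
    p delta = p theta_i / p_i. *)
Let bound x : finner_bound mu S w (full d) G x =
  (\prod_i ((B i x) `^ (pe i)^-1) `^ (theta i)) `^ p.
Proof.
rewrite /finner_bound big_sumType/= -big_split/=.
rewrite poweR_prod => [|i _]; last exact: poweR_ge0.
apply: eq_bigr => i _; rewrite (eq_filter (a2 := predT))// filter_predT itg_inl.
have e : ((pe i)^-1 * (theta i * p) = theta i * p + p * delta)%R.
  by rewrite mulrA [((pe i)^-1 * _)%R]mulrC thetape mulrDl [(delta * p)%R]mulrC.
rewrite -!poweRrM e.
by rewrite poweRD// /poweRD_def gt_eqF// addr_gt0// mulr_gt0.
Qed.

(** The exponent of m_i in F is theta_i p (p_i - 1) + p delta p_i = 0, so only phi to the power p *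
    sum theta_i remains. The hypotheses keep every m_i in ]0, +oo[ where phi > 0, so that this can
    be checked on logarithms. *)
Let pointwise z : (forall i, m i z = 0 -> phi z = 0) -> F z < +oo ->
  phi z `^ p = F z.
Proof.
move=> mz Foo; have [phi0|phi0] := eqVneq (phi z) 0.
  rewrite phi0 poweR0r ?gt_eqF//.
  apply/esym; rewrite /F/wprod.
  apply: (@prode_eq0 _ K xpredT _ (inl (Ordinal d0))) => //=.
  by rewrite phi0 mule0 poweR0r// gt_eqF// mulr_gt0.
have phi1 : 0 < phi z by rewrite lt_neqAle eq_sym phi0 mphi.2.
have m0 i : 0 < m i z.
  rewrite lt_neqAle (mm i).2 andbT eq_sym; apply/eqP => /mz e.
  by rewrite e eqxx in phi0.
have F01 : 0 < F z < +oo.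
  rewrite Foo andbT; apply: prode_gt0 => -[] i _; apply: poweR_gt0.
    by rewrite mule_gt0// poweR_gt0.
  by rewrite /= poweR_gt0.
have m01 i : 0 < m i z < +oo.
  apply: (gt0_lty_poweR (pe0 i) (ltW (m0 i))).
  exact: (wprod_gt0_lty w0 mG F01 (inr i)).
have fin_exp (x : \bar R) : 0 < x < +oo -> x = (expR (ln (fine x)))%:E.
  move: x => [x| |]//=; rewrite ?lte_fin ?ltxx ?andbF// => /andP[x0 _].
  by rewrite lnK// posrE.
have phi01 : 0 < phi z < +oo by rewrite phi1 phioo.
have := fin_exp _ phi01; set a := ln _ => phiE.
pose b i := ln (fine (m i z)).
have mE i : m i z = (expR (b i))%:E by exact: fin_exp.
transitivity (\prod_i (expR (theta i * (a * p)))%:E).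
  by rewrite prodEFin -expR_sum -mulr_suml theta1 mul1r phiE poweR_EFin expRM.
rewrite /F /wprod big_sumType/= -big_split/=; apply: eq_bigr => i _.
rewrite phiE mE !poweR_EFin -!expRM -EFinM -expRD -expRM -expRD.
congr ((expR _)%:E).
have -> : (delta = theta i / pe i - theta i)%R by rewrite thetape addrC addKr.
have pei := gt_eqF (pe0 i).
by field; rewrite pei.
Qed.

(** If m_i = 0 then phi vanishes for almost every x_i; taking i as the innermost index turns this
    into a statement on the full space. *)
Let aes_support x : aes mu (full d) (fun z => forall i, m i z = 0 -> phi z = 0) x.
Proof.
suff H i : aes mu (full d) (fun z => m i z = 0 -> phi z = 0) x.
  have : aes mu (full d) (fun z => forall i, i \in enum 'I_d -> m i z = 0 -> phi z = 0) x.
    elim: (enum 'I_d) => [|i s ih]; first by apply: aes_true.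
    apply: (aes_mono2 _ (H i) ih) => z hi hs j; rewrite in_cons => /orP[/eqP->//|].
    exact: hs.
  by apply: aes_mono => z hz i; apply: hz; rewrite mem_enum.
have mP : measurable [set z | m i z = 0 -> phi z = 0].
  rewrite (_ : [set _ | _] = ~` [set z | m i z = 0] `|` [set z | phi z = 0]).
    apply: measurableU; first apply: measurableC.
      exact: (measurable_eq_nnmeas (mm i) (nnmeas_cst (lexx 0))).
    exact: (measurable_eq_nnmeas mphi (nnmeas_cst (lexx 0))).
  apply/seteqP; split=> z /=; last by case.
  by move=> H; have [mz|mz] := pselect (m i z = 0); [right; exact: H|left].
have := perm_full_omit i; rewrite perm_sym => pm.
apply: (aes_perm mP pm) => /=; apply: aes_true => y.
have [my|my] := pselect (m i y = 0); last by apply: filterE => t; rewrite m_upd.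
have : {ae mu i, forall t, phi (upd y t) = 0}.
  by apply/ge0_ae_eq0 => //; [exact: nnmeas_sec|move=> t; exact: mphi.2].
by apply: filterS => t.
Qed.

Lemma itg_poweR_le x : itg mu (full d) (fun z => phi z `^ p) x <=
  (\prod_i ((B i x) `^ (pe i)^-1) `^ (theta i)) `^ p.
Proof.
rewrite -bound.
apply: (@le_trans _ _ (itg mu (full d) F x)).
  apply: aes_itg_le => //; first exact: nnmeas_poweR.
  apply: aes_mono (aes_support x) => z hz.
  have [Foo|] := ltP (F z) +oo; first by rewrite pointwise.
  by rewrite leye_eq => /eqP ->; rewrite leey.
by apply: finner.
Qed.

Definition lnorm (s : seq 'I_d) (q : R) (g : Om -> \bar R) (x : Om) : \bar R :=
  itg mu s (fun z => g z `^ q) x `^ q^-1.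

Let rhs x := \prod_i lnorm (omit i) (pe i) (int1 mu i phi) x `^ theta i.

Lemma adjoint_loomis_whitney x :
  lnorm (full d) p phi x <=
  \prod_i lnorm (omit i) (pe i) (int1 mu i phi) x `^ theta i.
Proof.
have r0 : 0 <= rhs x by apply: prode_ge0 => i _; exact: poweR_ge0.
rewrite -/(rhs x) -[leRHS]poweRe1// -(mulfV (lt0r_neq0 p0)) poweRrM.
apply: gt0_ler_poweR; rewrite ?invr_ge0 ?(ltW p0)//.
- rewrite in_itv/= leey andbT.
  by apply: (nnmeas_itg mu _ (nnmeas_poweR _ _)).2.
- by rewrite in_itv/= leey andbT poweR_ge0.
- exact: itg_poweR_le.
Qed.

Section equality.
Variable x : Om.
Hypothesis rhs01 : 0 < rhs x < +oo.
Hypothesis eq_rhs : lnorm (full d) p phi x = rhs x.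

Let C := rhs x `^ p.

Let C01 : 0 < C < +oo.
Proof. exact: poweR_gt0_lty. Qed.

Let itg_phi : itg mu (full d) (fun z => phi z `^ p) x = C.
Proof.
rewrite /C -eq_rhs /lnorm -poweRrM mulVf ?gt_eqF// poweRe1//.
by apply: (nnmeas_itg mu _ (nnmeas_poweR _ _)).2.
Qed.

(** Squeeze: C is the integral of phi^p, which is at most that of F, which is at most C by
    Finner. *)
Let itg_F : itg mu (full d) F x = C.
Proof.
apply/eqP; rewrite eq_le; apply/andP; split.
  by rewrite /C /rhs /lnorm -bound; apply: finner.
rewrite -itg_phi; apply: aes_itg_le => //; first exact: nnmeas_poweR.
apply: aes_mono (aes_support x) => z hz.
have [Foo|] := ltP (F z) +oo; first by rewrite pointwise.
by rewrite leye_eq => /eqP ->; rewrite leey.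
Qed.

Let phi_F s : perm_eq (full d) s ->
  aes mu s (fun z => phi z `^ p = F z /\ F z < +oo) x.
Proof.
move=> ps; apply: aes_and; last first.
  by apply: aes_lty => //; rewrite -(itg_perm mu ps)// itg_F; case/andP: C01.
apply: (aes_perm (measurable_eq_nnmeas (nnmeas_poweR p mphi) mF) ps).
have Foo : aes mu (full d) (fun z => F z < +oo) x.
  by apply: aes_lty => //; rewrite itg_F; case/andP: C01.
by apply: (aes_mono2 _ (aes_support x) Foo) => z; exact: pointwise.
Qed.

Let B01 i : 0 < B i x < +oo.
Proof.
have := rhs01; rewrite /rhs /lnorm => h.
have h1 := @prode_gt0_lty _ _ xpredT _ i (fun j => poweR_ge0 _ _) h isT.
have h2 := gt0_lty_poweR (theta0 i) (poweR_ge0 _ _) h1.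
have pei : (0 < (pe i)^-1)%R by rewrite invr_gt0.
apply: (gt0_lty_poweR pei _ h2).
exact: (nnmeas_itg mu _ (nnmeas_poweR _ (mm i))).2.
Qed.

Let sep (i j : 'I_d) : i \in full d -> j \in full d -> i != j ->
  exists k, S k i && ~~ S k j.
Proof. by move=> _ _ ij; exists (inr j); rewrite /= ij eqxx. Qed.

Let tensor : exists g : forall j, T j -> \bar R,
  [/\ forall j, measurable_fun setT (g j),
      forall j t, 0 <= g j t,
      forall j, \int[mu j]_t g j t = 1,
      aes mu (full d) (fun z => F z = C * \prod_(j <- full d) g j (z j)) x &
      forall i, aes mu (full d) (fun z => G (inl i) z * C = B i x * F z) x].
Proof.
have bC : finner_bound mu S w (full d) G x = C by rewrite bound.
have [|[g [mg g0 g1 gE]] Gfull] := @finner_eq _ _ _ _ mu _ S w w0 (full d) G x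
  (enum_uniq _) (fun j _ => sumw j) sep mG dG _ (etrans itg_F (esym bC)).
  by rewrite bC.
exists g; split => //.
- by move=> j; apply: g1; exact: in_full.
- by rewrite itg_F in gE.
- move=> i; have := Gfull (inl i); rewrite itg_F itg_inl; apply.
  by apply/allP.
Qed.

Hypothesis p1 : (p < 1)%R.

Lemma full_omit (i : 'I_d) (h : 'I_d -> \bar R) :
  \prod_(j <- full d) h j = h i * \prod_(j <- omit i) h j.
Proof. by rewrite (perm_big _ (perm_full_omit i)) big_cons. Qed.

(** On a fibre in direction x_i where phi = v > 0, proportionality of phi f_i^(p_i-1) to F = v^p
    determines v^(p-1), hence v as p < 1. So F takes one nonzero value on the fibre, and so does its
    factor g_i. *)
Let constant (g : forall j, T j -> \bar R) i :
  (forall j, measurable_fun setT (g j)) -> (forall j t, 0 <= g j t) ->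
  aes mu (full d) (fun z => F z = C * \prod_(j <- full d) g j (z j)) x ->
  aes mu (full d) (fun z => G (inl i) z * C = B i x * F z) x ->
  exists2 kappa : \bar R, 0 < kappa < +oo &
    {ae mu i, forall t, g i t = 0 \/ g i t = kappa}.
Proof.
move=> mg g0 gE GE.
have pi_ := perm_full_omit i.
have mg' : nnmeas (fun z : Om => C * \prod_(j <- full d) g j (z j)).
  apply: nnmeasM; first by apply: nnmeas_cst; exact: poweR_ge0.
  by apply: nnmeas_prod => j; exact: nnmeas_coord.
have {}gE := aes_perm (measurable_eq_nnmeas mF mg') pi_ gE.
have mGC : nnmeas (fun z => G (inl i) z * C).
  by apply: (nnmeasM (mG (inl i))); apply: nnmeas_cst; exact: poweR_ge0.
have mBF : nnmeas (fun z => B i x * F z).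
  by apply: nnmeasM => //; apply: nnmeas_cst; apply/ltW; case/andP: (B01 i).
have {}GE := aes_perm (measurable_eq_nnmeas mGC mBF) pi_ GE.
have Q := aes_and (aes_and gE GE) (phi_F pi_).
(* A fibre with the almost-everywhere relations on which F is not almost everywhere 0; without one
   the integral of F would be 0 instead of C. *)
have [y Qy Fy] : exists2 y : Om, {ae mu i, forall t,
    (F (upd y t) = C * \prod_(j <- full d) g j (upd y t j) /\
     G (inl i) (upd y t) * C = B i x * F (upd y t)) /\
    (phi (upd y t) `^ p = F (upd y t) /\ F (upd y t) < +oo)} &
    ~ {ae mu i, forall t, F (upd y t) = 0}.
  apply: contrapT => H.
  suff : aes mu (i :: omit i) (fun z => F z = 0) x.
    move=> /(aes_itg0 mu _ _ mF).2; rewrite -(itg_perm mu pi_)// itg_F => C0.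
    by move: C01; rewrite C0 ltxx.
  apply: (@aes_mono _ _ _ _ mu (omit i) _ _ x _ Q) => y Qy.
  by apply: contrapT => Fy; apply: H; exists y.
have prodE (t : T i) : \prod_(j <- full d) g j (upd y t j) =
    g i t * \prod_(j <- omit i) g j (y j).
  rewrite (full_omit i) upd_same; congr (_ * _).
  rewrite /omit !big_filter; apply: eq_bigr => j ji.
  by rewrite upd_other// eq_sym.
set a := \prod_(j <- omit i) g j (y j) in prodE.
have a0 : 0 <= a by exact: prode_ge0.
have GyE (t : T i) : G (inl i) (upd y t) = m i y `^ (pe i - 1) * phi (upd y t).
  by rewrite /G m_upd.
set M := m i y `^ (pe i - 1) in GyE.
have M0 : 0 <= M by exact: poweR_ge0.
(* At a point of this fibre with F != 0, v is the value of phi, and M v C = B_i v^p is divided by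
   v. *)
have facts (t : T i) :
    (F (upd y t) = C * \prod_(j <- full d) g j (upd y t j) /\
     G (inl i) (upd y t) * C = B i x * F (upd y t)) /\
    (phi (upd y t) `^ p = F (upd y t) /\ F (upd y t) < +oo) ->
    F (upd y t) != 0 ->
    [/\ 0 < a < +oo, 0 < g i t < +oo, F (upd y t) = C * (g i t * a) &
      exists2 v : R, (0 < v)%R & F (upd y t) = (v `^ p)%:E /\
        M * C = B i x * (v `^ (p - 1))%:E].
  move=> [[gF GF] [pF Foo]] F0.
  have F01 : 0 < F (upd y t) < +oo by rewrite Foo lt_neqAle eq_sym F0 mF.2.
  rewrite prodE in gF; have := F01; rewrite gF.
  move=> /(mule_gt0_lty (poweR_ge0 _ _) (mule_ge0 (g0 _ _) a0))/andP[_].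
  move=> /(mule_gt0_lty (g0 _ _) a0)/andP[g01 a01]; split => //.
  have phi01 : 0 < phi (upd y t) < +oo.
    by apply: (gt0_lty_poweR p0 (mphi.2 _)); rewrite pF.
  have [v phiv] : exists v, phi (upd y t) = v%:E.
    exists (fine (phi (upd y t))); rewrite fineK// ge0_fin_numE ?mphi.2//.
  have v0 : (0 < v)%R by case/andP: phi01; rewrite phiv lte_fin.
  exists v => //; split; first by rewrite -gF -pF phiv poweR_EFin.
  have v01 : 0 < v%:E < +oo by rewrite lte_fin v0 ltry.
  apply: (mule_cancel v01); move: GF; rewrite GyE -pF phiv poweR_EFin => GF.
  rewrite muleA [v%:E * M]muleC GF muleCA; congr (_ * _).
  rewrite -EFinM -[X in (X * _)%R](powRr1 (ltW v0)) -powRD; last first.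
    by rewrite (gt_eqF v0) implybT.
  by rewrite addrC subrK.
have [t0 Qt0 Ft0] : exists2 t0 : T i,
    (F (upd y t0) = C * \prod_(j <- full d) g j (upd y t0 j) /\
     G (inl i) (upd y t0) * C = B i x * F (upd y t0)) /\
    (phi (upd y t0) `^ p = F (upd y t0) /\ F (upd y t0) < +oo) &
    F (upd y t0) != 0.
  apply: contrapT => H; apply: Fy; apply: filterS Qy => t Qt.
  by apply: contrapT => /eqP Ft; apply: H; exists t.
have [a01 g01 E0 [v0 v00 [F0v M0v]]] := facts _ Qt0 Ft0.
exists (g i t0) => //; apply: filterS Qy => t Qt.
have [Ft|Ft] := eqVneq (F (upd y t)) 0.
  left; move: Ft; rewrite Qt.1.1 prodE => /eqP; rewrite mule_eq0 => /orP[/eqP C0|].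
    by move: C01; rewrite C0 ltxx.
  rewrite mule_eq0 => /orP[/eqP//|/eqP a00].
  by move: a01; rewrite a00 ltxx.
right; have [_ gt01 Et [v v1 [Fv Mv]]] := facts _ Qt Ft.
(* Both v^(p-1) and v0^(p-1) equal M C / B_i; taking logarithms, p - 1 != 0 cancels. *)
have vv : v = v0.
  have /eqP := mule_cancel (B01 i) (etrans (esym Mv) M0v).
  rewrite eqe => /eqP /(congr1 (@ln R)); rewrite !ln_powR => /mulfI h.
  apply: ln_inj; rewrite ?posrE//; apply: h.
  by rewrite subr_eq0 lt_eqF.
apply: (mule_cancel a01); rewrite ![a * _]muleC; apply: (mule_cancel C01).
by rewrite -Et -E0 Fv F0v vv.
Qed.

Lemma adjoint_loomis_whitney_eq :
  exists (E : forall j : 'I_d, set (T j)) (c : R),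
    [/\ forall j, measurable (E j) /\ 0 < mu j (E j) < +oo, (0 < c)%R &
        aes mu (full d)
          (fun z => phi z = (c * \prod_(j < d) \1_(E j) (z j))%:E) x].
Proof.
have [g [mg g0 g1 gE GE]] := tensor.
have /choice [kappa kP] : forall i, exists kappa : \bar R, 0 < kappa < +oo /\
    {ae mu i, forall t, g i t = 0 \/ g i t = kappa}.
  by move=> i; have [k] := constant (i := i) mg g0 gE (GE i); exists k.
(* As kappa_j > 0 and g_j takes almost only the values 0 and kappa_j, g_j is kappa_j times the
   indicator of E_j; its integral 1 makes mu_j(E_j) = 1/kappa_j positive and finite. *)
pose E j := [set t | g j t = kappa j].
have mE j : measurable (E j).
  rewrite /E -[X in measurable X]setTI.
  exact: (measurable_eqe measurableT (mg j) (measurable_cst _)).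
have gI j : {ae mu j, forall t, g j t = kappa j * (\1_(E j) t)%:E}.
  apply: filterS (kP j).2 => t [gt|gt]; last first.
    by rewrite indicE mem_set ?mule1.
  rewrite indicE memNset ?mule0// /E/= gt => k0.
  by have := (kP j).1; rewrite -k0 ltxx.
have muE j : kappa j * mu j (E j) = 1.
  rewrite -(g1 j).
  transitivity (\int[mu j]_t (kappa j * (\1_(E j) t)%:E)).
    rewrite ge0_integralZl//.
    + by rewrite integral_indic// setIT.
    + by apply/measurable_EFinP; exact: measurable_indic.
    + by apply/ltW; case/andP: (kP j).1.
  apply/esym/ge0_ae_eq_integral => //.
  - apply: measurable_funeM; apply/measurable_EFinP; exact: measurable_indic.
  - by move=> t _; rewrite mule_ge0// ltW//; case/andP: (kP j).1.
  - by apply: filterS (gI j).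
have muE01 j : 0 < mu j (E j) < +oo.
  have : 0 < kappa j * mu j (E j) < +oo by rewrite muE lte01 ltry.
  by move=> /mule_gt0_lty; case/(_ _ _)/andP => //; apply/ltW; case/andP: (kP j).1.
(* D is the nonzero value of F = phi^p, so the constant c is its p-th root. *)
pose D := C * \prod_(j <- full d) kappa j.
have D01 : 0 < D < +oo.
  by apply: gt0_lty_mule => //; apply: gt0_lty_prode => j _; exact: (kP j).1.
have Dp01 : 0 < D `^ p^-1 < +oo by exact: poweR_gt0_lty.
exists E, (fine (D `^ p^-1)); split => //.
  by rewrite fine_gt0.
have fineD : (fine (D `^ p^-1))%:E = D `^ p^-1.
  by rewrite fineK// ge0_fin_numE ?poweR_ge0//; case/andP: Dp01.
have gz : aes mu (full d) (fun z => forall j, j \in full d ->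
    g j (z j) = kappa j * (\1_(E j) (z j))%:E) x.
  have H i : aes mu (full d) (fun z => g i (z i) = kappa i * (\1_(E i) (z i))%:E) x.
    exact: (aes_coord x (gI i) (in_full i)).
  suff gs (s : seq 'I_d) : aes mu (full d) (fun z => forall j, j \in s ->
      g j (z j) = kappa j * (\1_(E j) (z j))%:E) x by exact: gs.
  elim: s => [|i s ih]; first by apply: aes_true.
  apply: (aes_mono2 _ (H i) ih) => z hi hs j; rewrite in_cons => /orP[/eqP->//|].
  exact: hs.
have ppF := phi_F (perm_refl _).
apply: (aes_mono2 _ (aes_and gE gz) ppF) => z [Fz gzz] [pF _].
have phiE : phi z = F z `^ p^-1.
  by rewrite -pF -poweRrM mulfV ?gt_eqF// poweRe1// mphi.2.
rewrite EFinM fineD phiE Fz (eq_big_seq _ gzz) big_split/= muleA -/D.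
rewrite poweRM//; last 2 first.
- by case/andP: D01 => /ltW.
- by apply: prode_ge0.
congr (_ * _); rewrite -prodEFin poweR_prod//.
rewrite /full big_enum/=; apply: eq_bigr => j _.
rewrite indicE; case: (_ \in _) => /=; first by rewrite powR1.
by rewrite powR0// invr_eq0 gt_eqF.
Qed.

End equality.

End adjoint.

(** * Iterated integrals of tensor products *)

Section tensor_products.
Context {R : realType} {I : eqType} {disp : I -> measure_display}.
Context {T : forall i : I, measurableType (disp i)}.
Variable mu : forall i, {sigma_finite_measure set (T i) -> \bar R}.
Local Open Scope ereal_scope.

Lemma itg_prod (s : seq I) (h : forall j, T j -> \bar R) (x : Pi T) :
  uniq s -> (forall j, measurable_fun setT (h j)) -> (forall j t, 0 <= h j t) ->
  itg mu s (fun z => \prod_(j <- s) h j (z j)) x =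
  \prod_(j <- s) \int[mu j]_t h j t.
Proof.
move=> + mh h0; elim: s => [_|j s ih /= /andP[js us]]; first by rewrite /= !big_nil.
have mp : nnmeas (fun z : Pi T => \prod_(i <- s) h i (z i)).
  by apply: nnmeas_prod => i; exact: nnmeas_coord.
rewrite big_cons -ih// -itg_cstl//; last by apply: integral_ge0.
congr (itg mu s _ x); apply/funext => z; rewrite /int1.
transitivity (\int[mu j]_t (h j t * \prod_(i <- s) h i (z i))).
  apply: eq_integral => t _; rewrite big_cons upd_same; congr (_ * _).
  rewrite !big_seq; apply: eq_bigr => i si.
  by rewrite upd_other//; apply: contraNneq js => ->.
by rewrite ge0_integralZr//; exact: mp.2.
Qed.

End tensor_products.

(** * Equality for multiples of indicators of boxes *)

Section adjoint_converse.
Context {R : realType} {d : nat} {disp : 'I_d -> measure_display}.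
Context {T : forall i : 'I_d, measurableType (disp i)}.
Variable mu : forall i, {sigma_finite_measure set (T i) -> \bar R}.
Variables (p delta : R) (theta pe : 'I_d -> R).
Hypothesis d0 : (0 < d)%N.
Hypothesis p0 : 0 < p.
Hypothesis pdelta : d.-1%:R * delta = p^-1 - 1.
Hypothesis theta1 : \sum_i theta i = 1.
Hypothesis pe0 : forall i, 0 < pe i.
Hypothesis thetape : forall i, theta i / pe i = theta i + delta.
Local Open Scope ereal_scope.
Variables (phi : Pi T -> \bar R) (x : Pi T).
Hypothesis mphi : nnmeas phi.
Variables (E : forall j : 'I_d, set (T j)) (c : R).
Arguments E : clear implicits.
Hypothesis mE : forall j, measurable (E j) /\ 0 < mu j (E j) < +oo.
Hypothesis c0 : (0 < c)%R.
Hypothesis phiE : aes mu (full d)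
  (fun z => phi z = (c * \prod_(j < d) \1_(E j) (z j))%:E) x.

Let h j (t : T j) : \bar R := (\1_(E j) t)%:E.
Arguments h : clear implicits.

Let mh j : measurable_fun setT (h j).
Proof.
by apply/measurable_EFinP; apply: measurable_indic; exact: (mE j).1.
Qed.

Let h0 j t : 0 <= h j t.
Proof. by rewrite lee_fin. Qed.

Let hX j t (q : R) : (0 < q)%R -> h j t `^ q = h j t.
Proof.
move=> q0; rewrite /h indicE; case: (_ \in _) => /=.
  by rewrite powR1.
by rewrite powR0 ?gt_eqF.
Qed.

(** Measures and the constant c are written as exponentials, so that the equality of norms reduces
    to a linear identity between exponents. *)
Let ep j := ln (fine (mu j (E j))).

Let ih j : \int[mu j]_t h j t = (expR (ep j))%:E.
Proof.
have [mEj /andP[E0 Eoo]] := mE j.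
rewrite integral_indic// setIT /ep lnK; last by rewrite posrE fine_gt0// E0.
by rewrite fineK// ge0_fin_numE.
Qed.

Let gam := ln c.

Let cE : c = expR gam.
Proof. by rewrite lnK. Qed.

Let psi (z : Pi T) := c%:E * \prod_(j <- full d) h j (z j).

Let phi_psi : aes mu (full d) (fun z => phi z = psi z) x.
Proof.
apply: aes_mono phiE => z ->; rewrite /psi EFinM -prodEFin.
by rewrite /full big_enum.
Qed.

Let mprod s : nnmeas (fun z : Pi T => \prod_(j <- s) h j (z j)).
Proof. by apply: nnmeas_prod => j; exact: nnmeas_coord. Qed.

Let mpsi : nnmeas psi.
Proof.
by apply: nnmeasM => //; apply: nnmeas_cst; rewrite lee_fin ltW.
Qed.

Let itg_tensor s (b q : R) : uniq s -> (0 < q)%R ->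
  itg mu s (fun z => ((expR b)%:E * \prod_(j <- s) h j (z j)) `^ q) x =
  (expR (b * q + \sum_(j <- s) ep j))%:E.
Proof.
move=> us q0.
have -> : (fun z : Pi T => ((expR b)%:E * \prod_(j <- s) h j (z j)) `^ q) =
    (fun z => (expR (b * q))%:E * \prod_(j <- s) h j (z j)).
  apply/funext => z; rewrite poweRM ?lee_fin ?expR_ge0 ?prode_ge0//.
  rewrite poweR_EFin -expRM poweR_prod//; congr (_ * _).
  by apply: eq_bigr => j _; rewrite hX.
rewrite itg_cstl ?lee_fin ?expR_ge0// itg_prod//.
by under eq_bigr do rewrite ih; rewrite prodEFin -expR_sum -EFinM -expRD.
Qed.

Let marginalE i : aes mu (omit i) (fun y => int1 mu i phi y =
  (expR (gam + ep i))%:E * \prod_(j <- omit i) h j (y j)) x.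
Proof.
have H := aes_perm (measurable_eq_nnmeas mphi mpsi) (perm_full_omit i) phi_psi.
apply: (@aes_mono _ _ _ _ mu (omit i) _ _ x _ H) => y /(int1_ae_eq mphi mpsi) ->; rewrite /int1.
set a := \prod_(j <- omit i) h j (y j).
have a0 : 0 <= a by exact: prode_ge0.
transitivity (\int[mu i]_t ((c%:E * a) * h i t)).
  apply: eq_integral => t _; rewrite /psi (full_omit i) upd_same muleCA muleC.
  congr (_ * _ * _); rewrite /a /omit !big_filter; apply: eq_bigr => j ji.
  by rewrite upd_other// eq_sym.
rewrite ge0_integralZl//; last by rewrite mule_ge0// lee_fin ltW.
by rewrite ih cE expRD EFinM -!muleA [a * _]muleC.
Qed.

Lemma adjoint_loomis_whitney_indic :
  lnorm mu (full d) p phi x =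
  \prod_i lnorm mu (omit i) (pe i) (int1 mu i phi) x `^ theta i.
Proof.
have sE (i : 'I_d) : (\sum_(j <- omit i) ep j = \sum_j ep j - ep i)%R.
  have : (\sum_(j <- full d) ep j = ep i + \sum_(j <- omit i) ep j)%R.
    by rewrite (perm_big _ (perm_full_omit i)) big_cons.
  by rewrite {1}/full big_enum/= => ->; rewrite addrAC subrr add0r.
have uo i : uniq (@omit d i) by rewrite filter_uniq// enum_uniq.
transitivity (expR ((gam * p + \sum_j ep j) / p))%:E.
  rewrite /lnorm (@aes_itg_eq _ _ _ _ mu _ _ (fun z => psi z `^ p)); last first.
  - by apply: aes_mono phi_psi => z ->.
  - exact: nnmeas_poweR.
  - exact: nnmeas_poweR.
  rewrite /psi cE itg_tensor ?enum_uniq// poweR_EFin -expRM.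
  by rewrite /full big_enum.
have lE i : lnorm mu (omit i) (pe i) (int1 mu i phi) x =
    (expR (((gam + ep i) * pe i + (\sum_j ep j - ep i)) / pe i))%:E.
  have mi := nnmeas_int1 mu i mphi.
  have mt : nnmeas (fun y : Pi T =>
      (expR (gam + ep i))%:E * \prod_(j <- omit i) h j (y j)).
    by apply: nnmeasM => //; apply: nnmeas_cst; rewrite lee_fin expR_ge0.
  rewrite /lnorm (aes_itg_eq (nnmeas_poweR (pe i) mi) (nnmeas_poweR (pe i) mt)).
    by rewrite itg_tensor// sE poweR_EFin -expRM.
  by apply: aes_mono (marginalE i) => z ->.
transitivity (\prod_i (expR (((gam + ep i) * pe i +
    (\sum_j ep j - ep i)) / pe i * theta i))%:E); last first.
  by apply: eq_bigr => i _; rewrite lE poweR_EFin -expRM.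
rewrite prodEFin -expR_sum; congr ((expR _)%:E).
set A := (\sum_j ep j)%R.
(* Since theta_i / p_i = theta_i + delta, the i-th exponent is theta_i (gam + A) + delta (A - ep_i).
   These sum to gam + A + (d - 1) delta A = gam + A / p. *)
transitivity (\sum_i (theta i * (gam + A) + delta * (A - ep i)))%R.
  rewrite big_split/= -mulr_suml theta1 mul1r -mulr_sumr sumrB sumr_const card_ord.
  have -> : (A *+ d = d.-1%:R * A + A)%R.
    have dE : (d%:R = d.-1%:R + 1 :> R)%R by rewrite natr1 prednK.
    by rewrite -[LHS]mulr_natl dE mulrDl mul1r.
  rewrite -/A addrK mulrA [(delta * _)%R]mulrC pdelta.
  by field; rewrite gt_eqF.
apply: eq_bigr => i _.
have -> : (delta = theta i / pe i - theta i)%R by rewrite thetape addrC addKr.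
by field; rewrite gt_eqF.
Qed.

End adjoint_converse.

(** * The Loomis-Whitney inequality from Finner's inequality *)

Section loomis_whitney.
Context {R : realType} {d : nat} {disp : 'I_d -> measure_display}.
Context {T : forall i : 'I_d, measurableType (disp i)}.
Variable mu : forall i, {sigma_finite_measure set (T i) -> \bar R}.
Local Open Scope ereal_scope.

Lemma loomis_whitney (g : 'I_d -> Pi T -> \bar R) (x : Pi T) : (2 <= d)%N ->
  (forall i, nnmeas (g i)) -> (forall i, depends (predC1 i) (g i)) ->
  itg mu (full d) (fun z => \prod_i g i z) x <=
  \prod_i lnorm mu (omit i) d.-1%:R (g i) x.
Proof.
move=> d2 mg dg; have n0 : (0 < d.-1%:R :> R)%R by rewrite ltr0n -ltnS prednK// ltnW.
(* The weights 1/(d-1) undo this power, and each x_j occurs in exactly d - 1 of the functions. *)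
pose G i z := g i z `^ d.-1%:R.
pose w (i : 'I_d) : R := (d.-1%:R^-1)%R.
have -> : (fun z => \prod_i g i z) = wprod w G.
  apply/funext => z; apply: eq_bigr => i _.
  by rewrite /G -poweRrM mulfV ?gt_eqF// poweRe1// (mg i).2.
apply: (@finner _ _ _ _ mu _ (fun i => predC1 i) w) => //.
- by move=> i; rewrite /w invr_gt0.
- move=> j _; rewrite /w sumr_const -[X in (_ *+ X)%R](_ : d.-1 = _).
    by rewrite -[LHS]mulr_natl mulfV// gt_eqF.
  by rewrite -(card_neq j); apply: eq_card => i; rewrite !inE.
- by move=> i; exact: nnmeas_poweR.
- move=> i y z yz; rewrite /G (dg i y z)// => j ji; apply: yz.
  by rewrite /= in_full implyTb; exact: ji.
Qed.

End loomis_whitney.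

(** * Transfer to the spaces PS *)

Section bridge.
Context {R : realType} {d : nat} {disp : 'I_d -> measure_display}.
Context {T : forall i : 'I_d, measurableType (disp i)}.
Variable mu : forall i, {sigma_finite_measure set (T i) -> \bar R}.
Implicit Types (s : seq 'I_d) (x z : Pi T).

Definition restr s x : PS T s := fun j _ => x j.
Arguments restr : clear implicits.

(** Layer by layer the two integrals are convertible, and [PS [::]] has a single point. The equality
    holds for every base point x, since [pint] involves none. *)
Lemma pint_itg s (g : PS T s -> \bar R) x :
  pint (fun i => mu i : {measure set _ -> \bar R}) g =
  itg mu s (fun z => g (restr s z)) x.
Proof.
elim: s g => [|i s ih] g /=.
  congr g; apply/functional_extensionality_dep => j.
  by apply/functional_extensionality_dep => hj; have := hj; rewrite in_nil.
by rewrite ih.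
Qed.

(** The sets with measurable preimage under [restr s] form a sigma-algebra containing the generators
    of [psigma]. *)
Lemma psigma_restr s (A : set (PS T s)) :
  psigma A -> measurable [set x | A (restr s x)].
Proof.
move=> sA; apply: (sA [set A | measurable [set x : Pi T | A (restr s x)]]).
split; first split => /=.
- exact: measurable0.
- move=> B mB; rewrite (_ : [set _ | _] = ~` [set x | B (restr s x)]).
    exact: measurableC.
  by apply/seteqP; split => x /=; [case|].
- move=> B mB; rewrite (_ : [set _ | _] = \bigcup_i [set x | B i (restr s x)]).
    exact: bigcupT_measurable.
  by apply/seteqP; split => x [i _ Bi]; exists i.
move=> _ [j [h [A' [mA' ->]]]] /=.
have := @measurable_coord _ _ T j measurableT A' mA'.
by rewrite setTI.
Qed.

Lemma measurable_pcoord (A : set (Pi T)) : measurable A ->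
  psigma [set y : PS T (full d) | A (pcoord y)].
Proof.
move=> mA M [sM cM].
apply: (mA [set A | M [set y : PS T (full d) | A (pcoord y)]]).
have [M0 MC MU] := sM.
split; first split => /=.
- exact: M0.
- move=> B mB; rewrite (_ : [set _ | _] =
      [set: PS T (full d)] `\` [set y | B (pcoord y)]); first exact: MC.
  by apply/seteqP; split => y /=; case.
- move=> B mB; rewrite (_ : [set _ | _] =
      \bigcup_i [set y : PS T (full d) | B i (pcoord y)]); first exact: MU.
  by apply/seteqP; split => y [i _ Bi]; exists i.
move=> _ [j [A' [mA' ->]]] /=; apply: cM.
by exists j, (in_full j), A'.
Qed.

Lemma restr_pcoord (y : PS T (full d)) : restr (full d) (pcoord y) = y.
Proof.
apply/functional_extensionality_dep => j.
apply/functional_extensionality_dep => hj.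
by rewrite /restr /pcoord (bool_irrelevance (in_full j) hj).
Qed.

Lemma pmeasurable_restr s (g : PS T s -> R) : pmeasurable g ->
  (forall y, 0 <= g y) -> nnmeas (fun x => (g (restr s x))%:E).
Proof.
move=> mg g0; split; last by move=> x; rewrite lee_fin.
apply/measurable_EFinP => _ B mB; rewrite setTI.
exact: psigma_restr (mg B mB).
Qed.

Lemma depends_restr_omit (i : 'I_d) (g : PS T (omit i) -> \bar R) :
  depends (predC1 i) (fun x => g (restr (omit i) x)).
Proof.
move=> x y xy; congr g; apply/functional_extensionality_dep => j.
apply/functional_extensionality_dep => hj; apply: xy.
by move: hj; rewrite mem_filter => /andP[].
Qed.

Lemma marginal_int1 (f : PS T (full d) -> R) i x :
  marginal (fun i => mu i : {measure set _ -> \bar R}) f i (restr (omit i) x) =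
  int1 mu i (fun z => (f (restr (full d) z))%:E) x.
Proof.
by apply: eq_integral => t _; congr (f _)%:E.
Qed.

Lemma pnorm_lnorm s (p : R) (g : PS T s -> \bar R) x : (forall y, 0 <= g y)%E ->
  pnorm (fun i => mu i : {measure set _ -> \bar R}) p g =
  lnorm mu s p (fun z => g (restr s z)) x.
Proof.
move=> g0; rewrite /pnorm /lnorm (pint_itg _ x); congr (itg mu s _ x `^ _)%E.
by apply/funext => z; rewrite gee0_abs.
Qed.

End bridge.

Arguments restr {d disp T} s x j _.

(** * From the sigma-finiteness hypothesis to bundled sigma-finite measures *)

Section sigma_finite_measure_of.
Context d (T : measurableType d) (R : realType) (m : {measure set T -> \bar R}).
Hypothesis sm : sigma_finite setT m.

(* A copy of m, so that its sigma-finiteness can be declared to inference. *)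
Definition sigma_finite_copy & sigma_finite setT m : set T -> \bar R := m.

HB.instance Definition _ := isMeasure.Build d T R (sigma_finite_copy sm)
  (measure0 m) (measure_ge0 m) (@measure_semi_sigma_additive _ _ _ m).

HB.instance Definition _ := @Measure_isSigmaFinite.Build d T R
  (sigma_finite_copy sm) sm.

Lemma sigma_finite_measureP : exists m' : {sigma_finite_measure set T -> \bar R},
  (m' : {measure set T -> \bar R}) = m.
Proof. by exists (sigma_finite_copy sm); exact: eq_measure. Qed.

End sigma_finite_measure_of.

(** * The three parts on the spaces [PS], for bundled sigma-finite measures *)

Section theorem_sigma_finite.
Context {R : realType} {d : nat} {disp : 'I_d -> measure_display}.
Context {T : forall i : 'I_d, measurableType (disp i)}.
Variable mu : forall i, {sigma_finite_measure set (T i) -> \bar R}.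
Hypothesis hd : (2 <= d)%N.

Let nu (i : 'I_d) : {measure set (T i) -> \bar R} := mu i.
Let x0 : Pi T := point.

Let d1 : (0 < d.-1)%N.
Proof. by rewrite -ltnS prednK// ltnW. Qed.

Let n0 : 0 < d.-1%:R :> R.
Proof. by rewrite ltr0n. Qed.

Lemma loomis_whitney_PS (f : forall i : 'I_d, PS T (omit i) -> R) :
  (forall i y, 0 <= f i y) -> (forall i, pmeasurable (f i)) ->
  (pint nu (fun x : PS T (full d) => (\prod_(i < d) f i (drop_coord i x))%:E)
   <= \prod_(i < d) pnorm nu (d.-1)%:R (fun y => (f i y)%:E))%E.
Proof.
move=> f0 mf; rewrite (pint_itg mu _ x0).
under eq_bigr => i _.
  rewrite (pnorm_lnorm mu _ x0); last by move=> y; rewrite lee_fin.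
  over.
rewrite (_ : (fun z => _) = (fun z : Pi T =>
    \prod_i (f i (restr (omit i) z))%:E)%E).
  apply: loomis_whitney => // i; first exact: pmeasurable_restr.
  exact: (@depends_restr_omit _ _ _ _ i (fun y => (f i y)%:E)).
by apply/funext => z; rewrite -prodEFin.
Qed.

Variables (f : PS T (full d) -> R) (p : R).
Hypothesis f0 : forall x, 0 <= f x.
Hypothesis mf : pmeasurable f.
Hypothesis p01 : 0 < p <= 1.

Let phi (z : Pi T) : \bar R := (f (restr (full d) z))%:E.

Let mphi : nnmeas phi.
Proof. exact: pmeasurable_restr. Qed.

Let phioo z : (phi z < +oo)%E.
Proof. by rewrite ltry. Qed.

Let p0 : 0 < p.
Proof. by case/andP: p01. Qed.

Let pnorm_f : pnorm nu p (fun x => (f x)%:E) = lnorm mu (full d) p phi x0.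
Proof. by rewrite (pnorm_lnorm mu _ x0)// => y; rewrite lee_fin. Qed.

Let pnorm_marginal i q :
  pnorm nu q (marginal nu f i) = lnorm mu (omit i) q (int1 mu i phi) x0.
Proof.
rewrite (pnorm_lnorm mu _ x0); last first.
  by move=> y; apply: integral_ge0 => t _; rewrite lee_fin.
by congr (lnorm mu _ _ _ x0); apply/funext => z; rewrite marginal_int1.
Qed.

Section exponents.
Variables theta pe : 'I_d -> R.
Hypothesis theta0 : forall i, 0 < theta i.
Hypothesis theta1 : \sum_(i < d) theta i = 1.
Hypothesis thetap : forall i,
  (d.-1%:R)^-1 * (1 - p^-1) = theta i * (1 - (pe i)^-1).

Let delta := d.-1%:R^-1 * (p^-1 - 1).

Let pdelta : d.-1%:R * delta = p^-1 - 1.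
Proof. by rewrite /delta mulrA mulfV ?gt_eqF// mul1r. Qed.

Let thetape i : theta i / pe i = theta i + delta.
Proof.
have := thetap i; rewrite /delta => e.
have -> : d.-1%:R^-1 * (p^-1 - 1) = - (d.-1%:R^-1 * (1 - p^-1)) by ring.
by rewrite e; ring.
Qed.

Let delta_ge0 : 0 <= delta.
Proof.
apply: mulr_ge0; first by rewrite invr_ge0 ltW.
by rewrite subr_ge0 invf_ge1//; case/andP: p01.
Qed.

(** Positivity of p_i is forced by theta_i / p_i = theta_i + delta > 0; p_i = 0 is excluded too, as
    its quotient is 0 by convention. *)
Let pe0 i : 0 < pe i.
Proof.
have : 0 < theta i / pe i by rewrite thetape ltr_wpDr.
by rewrite pmulr_rgt0// invr_gt0.
Qed.

(** For p = 1, delta is 0 and every p_i is 1; by Tonelli each marginal has the integral of f, and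
    both sides agree because the theta_i sum to 1. *)
Lemma adjoint_PS : (pnorm nu p (fun x => (f x)%:E)
  <= \prod_(i < d) (pnorm nu (pe i) (marginal nu f i)) `^ (theta i))%E.
Proof.
rewrite pnorm_f; under eq_bigr do rewrite pnorm_marginal.
have [p1|p1] := eqVneq p 1; last first.
  apply: (@adjoint_loomis_whitney _ _ _ _ mu p delta) => //; first exact: ltnW.
  rewrite /delta mulr_gt0 ?invr_gt0// subr_gt0 invf_gt1//.
  by rewrite lt_neqAle p1; case/andP: p01.
have pe1 i : pe i = 1.
  have := thetape i; rewrite /delta p1 invr1 subrr mulr0 addr0 => e.
  have := mulfI (lt0r_neq0 (theta0 i)) (etrans e (esym (mulr1 _))).
  by move=> /(congr1 GRing.inv); rewrite invrK invr1.
have B0 : (0 <= itg mu (full d) phi x0)%E by apply: (nnmeas_itg mu _ mphi).2.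
have l1 s g : nnmeas g -> lnorm mu s 1 g x0 = itg mu s g x0.
  move=> mg; rewrite /lnorm invr1 poweRe1.
    by congr (itg mu s _ x0); apply/funext => z; rewrite poweRe1// mg.2.
  by apply: (nnmeas_itg mu _ (nnmeas_poweR _ _)).2.
have Bprod : itg mu (full d) phi x0 =
    (\prod_(i < d) itg mu (full d) phi x0 `^ theta i)%E.
  by rewrite -poweR_sum// theta1 poweRe1.
rewrite p1 l1// Bprod; apply: lee_prod => i _; rewrite pe1 l1; last exact: nnmeas_int1.
by rewrite poweR_ge0 (itg_perm mu (perm_full_omit i) mphi)/= lexx.
Qed.

Lemma adjoint_eq_PS : p < 1 ->
  (0 < \prod_(i < d) (pnorm nu (pe i) (marginal nu f i)) `^ (theta i) < +oo)%E ->
  (pnorm nu p (fun x => (f x)%:E)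
     = \prod_(i < d) (pnorm nu (pe i) (marginal nu f i)) `^ (theta i))%E
  <->
  exists (E : forall j : 'I_d, set (T j)) (c : R),
    (forall j, measurable (E j) /\ (0 < nu j (E j) < +oo)%E) /\
    0 < c /\
    pnull nu [set x : PS T (full d) |
               f x <> c * \prod_(j < d) \1_(E j) (pcoord x j)].
Proof.
move=> p1; rewrite pnorm_f.
have -> : (\prod_(i < d) (pnorm nu (pe i) (marginal nu f i)) `^ (theta i) =
    \prod_i lnorm mu (omit i) (pe i) (int1 mu i phi) x0 `^ theta i)%E.
  by apply: eq_bigr => i _; rewrite pnorm_marginal.
move=> rhs01.
have d0 : (0 < d)%N by exact: ltnW.
have delta0 : 0 < delta.
  by rewrite /delta mulr_gt0 ?invr_gt0// subr_gt0 invf_gt1.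
have mind (E : forall j : 'I_d, set (T j)) (c : R) :
    (forall j, measurable (E j)) -> 0 < c ->
    nnmeas (fun z : Pi T => (c * \prod_(j < d) \1_(E j) (z j))%:E).
  move=> mE c0; split=> [|z]; last first.
    by rewrite lee_fin mulr_ge0 ?(ltW c0)// prodr_ge0.
  apply/measurable_EFinP; apply: measurable_funM => //.
  apply: measurable_prod => j _.
  exact: (measurableT_comp (measurable_indic (mE j)) (@measurable_coord _ _ T j)).
split=> [e|[E [c [mE [c0 [M [sM [NM iM]]]]]]]].
  have [E [c [mE c0 phiE]]] := adjoint_loomis_whitney_eq d0 p0 delta0 pdelta
    theta0 theta1 pe0 thetape mphi phioo rhs01 e p1.
  exists E, c; split => //; split => //.
  set N := [set x | _].
  (* The exceptional set is measurable, so it is its own null cover in [pnull]. *)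
  have sN : psigma N.
    have mN : measurable (~` [set z : Pi T |
        phi z = (c * \prod_(j < d) \1_(E j) (z j))%:E]).
      apply: measurableC; apply: measurable_eq_nnmeas => //.
      by apply: mind => // j; case: (mE j).
    have := measurable_pcoord mN; congr psigma.
    apply/seteqP; split=> y /=; rewrite /phi restr_pcoord; apply: contra_not.
      by move=> ->.
    by move=> [].
  exists N; split => //; split => //.
  rewrite (pint_itg mu _ x0).
  apply/aes_itg0; last first.
    apply: aes_mono phiE => z; rewrite /phi => -[fz].
    by rewrite indicE memNset//= /N/=; apply.
  split; last by move=> z; rewrite lee_fin.
  apply/measurable_EFinP; apply: (@measurable_indic _ _ _ _ [set z | N (restr (full d) z)]).
  exact: psigma_restr.
apply: (adjoint_loomis_whitney_indic d0 p0 pdelta theta1 pe0 thetape mphi mE c0).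
rewrite (pint_itg mu _ x0) in iM.
(* Conversely, the indicator of the null cover M vanishes almost everywhere, and off M the function
   f is the multiple of the box indicator. *)
have : aes mu (full d) (fun z => ((\1_M (restr (full d) z))%:E = 0 :> \bar R)%E) x0.
  apply/aes_itg0 => //; split; last by move=> z; rewrite lee_fin.
  apply/measurable_EFinP; apply: (@measurable_indic _ _ _ _ [set z | M (restr (full d) z)]).
  exact: psigma_restr.
apply: aes_mono => z; rewrite indicE => h; congr EFin; apply: contrapT => fz.
have : M (restr (full d) z) by apply: NM.
by move=> Mz; move: h; rewrite mem_set//= => -[] /eqP; rewrite oner_eq0.
Qed.

End exponents.

Lemma adjoint_uniform_PS : (pnorm nu p (fun x => (f x)%:E)
  <= \prod_(i < d) (pnorm nu (p * (d.-1)%:R / (d%:R - p)) (marginal nu f i))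
       `^ (d%:R^-1))%E.
Proof.
have d0 : 0 < d%:R :> R by rewrite ltr0n ltnW.
have dp : 0 < d%:R - p.
  rewrite subr_gt0; have /andP[_ /le_lt_trans] := p01; apply.
  by rewrite ltr1n.
apply: (adjoint_PS (theta := fun=> d%:R^-1)
  (pe := fun=> p * (d.-1)%:R / (d%:R - p))) => [i||i].
- by rewrite invr_gt0.
- by rewrite sumr_const card_ord -[LHS]mulr_natl mulfV// gt_eqF.
(* This leaves [d.-1%:R] as the only form of d that [field] sees. *)
- have dE : d%:R = d.-1%:R + 1 :> R by rewrite natr1 prednK// ltnW.
  rewrite dE in d0 dp *.
  by field; rewrite !gt_eqF.
Qed.

End theorem_sigma_finite.

Theorem theorem2p1 (R : realType) (d : nat) (hd : (2 <= d)%N)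
  (disp : 'I_d -> measure_display) (T : forall i : 'I_d, measurableType (disp i))
  (mu : forall i : 'I_d, {measure set (T i) -> \bar R})
  (hmu : forall i : 'I_d, sigma_finite [set: T i] (mu i)) :
  (* (i) Loomis--Whitney type inequality *)
  (forall f : forall i : 'I_d, PS T (omit i) -> R,
     (forall i y, 0 <= f i y) -> (forall i, pmeasurable (f i)) ->
     (pint mu (fun x : PS T (full d) =>
         (\prod_(i < d) f i (drop_coord i x))%:E)
      <= \prod_(i < d) pnorm mu (d.-1)%:R (fun y => (f i y)%:E))%E) /\
  (* (ii) and its special case theta_i = 1/d, and (iii) the equality case *)
  (forall f : PS T (full d) -> R,
     (forall x, 0 <= f x) -> pmeasurable f ->
     forall p : R, 0 < p <= 1 ->
     [/\ (forall (theta pe : 'I_d -> R),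
            (forall i, 0 < theta i) -> \sum_(i < d) theta i = 1 ->
            (forall i, (d.-1%:R)^-1 * (1 - p^-1) = theta i * (1 - (pe i)^-1)) ->
            (pnorm mu p (fun x => (f x)%:E)
             <= \prod_(i < d) (pnorm mu (pe i) (marginal mu f i)) `^ (theta i))%E),
         (pnorm mu p (fun x => (f x)%:E)
          <= \prod_(i < d)
               (pnorm mu (p * (d.-1)%:R / (d%:R - p)) (marginal mu f i))
                 `^ (d%:R^-1))%E
       & (forall (theta pe : 'I_d -> R),
            (forall i, 0 < theta i) -> \sum_(i < d) theta i = 1 ->
            (forall i, (d.-1%:R)^-1 * (1 - p^-1) = theta i * (1 - (pe i)^-1)) ->
            p < 1 ->
            (0 < pnorm mu p (fun x => (f x)%:E) < +oo)%E ->
            (0 < \prod_(i < d) (pnorm mu (pe i) (marginal mu f i)) `^ (theta i)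
               < +oo)%E ->
            (pnorm mu p (fun x => (f x)%:E)
               = \prod_(i < d) (pnorm mu (pe i) (marginal mu f i)) `^ (theta i))%E
            <->
            exists (E : forall j : 'I_d, set (T j)) (c : R),
              (forall j, measurable (E j) /\ (0 < mu j (E j) < +oo)%E) /\
              0 < c /\
              pnull mu [set x : PS T (full d) |
                         f x <> c * \prod_(j < d) \1_(E j) (pcoord x j)])]).
Proof.
(* Choice replaces each mu_i by an equal measure that carries its sigma-finiteness. *)
have [mu' ->] : exists mu' : forall i, {sigma_finite_measure set (T i) -> \bar R},
    mu = fun i => mu' i.
  exists (fun i => projT1 (cid (sigma_finite_measureP (hmu i)))).
  apply/functional_extensionality_dep => i.
  by rewrite (projT2 (cid (sigma_finite_measureP (hmu i)))).
split; first exact: loomis_whitney_PS.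
move=> f f0 mf p p01; split.
- by move=> theta pe theta0 theta1 thetap; exact: adjoint_PS.
- exact: adjoint_uniform_PS.
- by move=> theta pe theta0 theta1 thetap p1 _ rhs01; exact: adjoint_eq_PS.
Qed.
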